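(* Let $k=k_{\mathcal X}\otimes k_{\mathcal Y}$ be $\mathfrak S_{\mathcal Z}$-measurable with $|k|\le 1$, where $k_{\mathcal X}$ and $k_{\mathcal Y}$ are continuous kernels on $\mathcal X$ and $\mathcal Y$ with $|k_{\mathcal X}|\le1$, $|k_{\mathcal Y}|\le 1$. Assume that for every $\theta\in\Theta$ there exists a bounded linear conditional mean embedding operator $\mathcal C_\theta:\mathcal H_{\mathcal X}\to\mathcal H_{\mathcal Y}$ for $(P_{g(\theta,x)})_{x\in\mathcal X}$ and that $\mathfrak C:=\sup_{\theta\in\Theta}\|\mathcal C_\theta\|_{\mathrm o}<\infty$. Let the pairs $(X_i^0,Y_i^0)$, $i=1,\dots,n$, be i.i.d. from a probability distribution $P^0$ on $\mathcal Z$, let $D_n^0=\{(X_i^0,Y_i^0)\}_{i=1}^n$, let $D_n=\{(X_i,Y_i)\}_{i=1}^n$ be an $\epsilon$-adversarial contamination of $D_n^0$, and let $\hat\theta_n$ be the MMD estimator computed from $D_n$. Then $$\mathbb E\big\{\mathbb D_k(P_{\hat\theta_n},P^0)\big\}\le 8\epsilon+\inf_{\theta\in\Theta}\mathbb D_k(P_\theta,P^0)+\frac{\mathfrak C+3}{\sqrt n},$$ and, for all $\eta\in(0,1)$, $$\mathbb P\Big[\mathbb D_k(P_{\hat\theta_n},P^0)<8\epsilon+\inf_{\theta\in\Theta}\mathbb D_k(P_\theta,P^0)+n^{-1/2}(\mathfrak C+3)\big\{1+\sqrt{2\log(4/\eta)}\big\}\Big]\ge1-\eta.$$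
   Context: $\mathcal X,\mathcal Y$ are topological spaces with Borel $\sigma$-algebras $\mathfrak S_{\mathcal X},\mathfrak S_{\mathcal Y}$; $\mathcal Z=\mathcal X\times\mathcal Y$, $\mathfrak S_{\mathcal Z}=\mathfrak S_{\mathcal X}\otimes\mathfrak S_{\mathcal Y}$. A kernel is a symmetric positive definite function; $\mathcal H,\mathcal H_{\mathcal X},\mathcal H_{\mathcal Y}$ are the RKHSs of $k,k_{\mathcal X},k_{\mathcal Y}$; $(k_{\mathcal X}\otimes k_{\mathcal Y})\{(x,y),(x',y')\}=k_{\mathcal X}(x,x')k_{\mathcal Y}(y,y')$. For probability distributions $P,Q$ on $\mathcal Z$, $\mathbb D_k(P,Q)=\|\mu(P)-\mu(Q)\|_{\mathcal H}$ with $\mu(P)=\mathbb E_{Z\sim P}[k(Z,\cdot)]$. Model: $\{P_\lambda,\lambda\in\Lambda\}$ is a set of probability distributions on $\mathcal Y$, $\Theta$ is a Polish space, and $g:\Theta\times\mathcal X\to\Lambda$ is such that $x\mapsto P_{g(\theta,x)}(A)$ is measurable for all $A\in\mathfrak S_{\mathcal Y}$, $\theta\in\Theta$. With $P^0_X$ the $\mathcal X$-marginal of $P^0$, $P_\theta(A\times B)=\mathbb E_{X\sim P_X^0}\{\mathbf 1_A(X)P_{g(\theta,X)}(B)\}$ for $A\in\mathfrak S_{\mathcal X},B\in\mathfrak S_{\mathcal Y}$. A conditional mean embedding operator of $(P_{g(\theta,x)})_{x\in\mathcal X}$ is a mapping $\mathcal C_\theta:\mathcal H_{\mathcal X}\to\mathcal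 H_{\mathcal Y}$ with $\mathcal C_\theta k_{\mathcal X}(x,\cdot)=\mathbb E_{Y\sim P_{g(\theta,x)}}[k_{\mathcal Y}(Y,\cdot)]$ for all $x\in\mathcal X$; $\|\cdot\|_{\mathrm o}$ is the operator norm. Estimator: with $\hat P^n=\frac1n\sum_{i=1}^n\delta_{(X_i,Y_i)}$ and $\hat P^n_\theta(A\times B)=\frac1n\sum_{i=1}^n\delta_{X_i}(A)P_{g(\theta,X_i)}(B)$, $\hat\theta_n\in\operatorname{argmin}_{\theta\in\Theta}\mathbb D_k^2(\hat P^n_\theta,\hat P^n)$, a minimizer assumed to exist and to be measurable. $\epsilon$-adversarial contamination: there is a set $I\subset\{1,\dots,n\}$ with $|I|/n\le\epsilon$ and $(X_i,Y_i)=(X_i^0,Y_i^0)$ for all $i\notin I$. *)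

(* Defs.v *)
From HB Require Import structures.
From mathcomp Require Import all_boot all_order all_algebra.
From mathcomp Require Import all_classical all_reals all_analysis.
From mathcomp Require Import measurable_realfun.

Set Implicit Arguments.
Unset Strict Implicit.
Unset Printing Implicit Defensive.

Import Order.TTheory GRing.Theory Num.Theory.
Import numFieldNormedType.Exports.

Local Open Scope classical_set_scope.
Local Open Scope ring_scope.

(* The library equips a product of measurable types with the product
   sigma-algebra, so [borel X * borel Y] carries the product of the two Borel
   sigma-algebras, not the Borel sigma-algebra of the product topology. *)
Notation borel T := (g_sigma_algebraType (@open T)).

(* Separable and completely metrizable; the metric is not part of the data. *)
Definition polish (R : realType) (T : topologicalType) :=
  (exists2 D : set T, countable D & dense D) /\
  exists d : T -> T -> R,
    [/\ forall x y, d x y = 0 <-> x = y,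
        forall x y, d x y = d y x,
        forall x y z, d x z <= d x y + d y z,
        forall x (A : set T),
          nbhs x A <-> exists2 e : R, 0 < e & [set y | d x y < e] `<=` A
      & forall u : nat -> T,
          (forall e : R, 0 < e ->
             exists N, forall i j, (N <= i)%N -> (N <= j)%N ->
               d (u i) (u j) < e) ->
          exists l : T, u @ \oo --> l].

Definition pd_kernel (R : realType) (T : Type) (k : T -> T -> R) :=
  (forall x y, k x y = k y x) /\
  (forall (m : nat) (c : 'I_m -> R) (x : 'I_m -> T),
     0 <= \sum_(i < m) \sum_(j < m) c i * c j * k (x i) (x j)).

Definition tensor_kernel (R : realType) (S T : Type)
    (k1 : S -> S -> R) (k2 : T -> T -> R) : S * T -> S * T -> R :=
  fun z z' => k1 z.1 z'.1 * k2 z.2 z'.2.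

Record hilbert (R : realType) := Hilbert {
  hilbert_sort :> completeNormedModType R ;
  dotp : hilbert_sort -> hilbert_sort -> R ;
  dotpC : forall f g, dotp f g = dotp g f ;
  dotpDl : forall f g h, dotp (f + g) h = dotp f h + dotp g h ;
  dotpZl : forall a f h, dotp (a *: f) h = a * dotp f h ;
  dotp_norm : forall f, dotp f f = `|f| ^+ 2 }.

(* A reproducing kernel Hilbert space of [k].  Its elements are real functions
   on [T] through the injective map [rkhs_fun], which is linear by
   [rkhs_reproducing].  By the Moore-Aronszajn theorem such a structure exists
   for every kernel and is unique up to an isometry compatible with
   [rkhs_fun]. *)
Record rkhs (R : realType) (T : Type) (k : T -> T -> R) := RKHS {
  rkhs_hilbert :> hilbert R ;
  rkhs_fun : rkhs_hilbert -> T -> R ;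
  rkhs_fun_inj : injective rkhs_fun ;
  feature : T -> rkhs_hilbert ;
  rkhs_featureE : forall x, rkhs_fun (feature x) = k x ;
  rkhs_reproducing : forall f x, dotp f (feature x) = rkhs_fun f x }.

Section mean.
Context (R : realType) (d : measure_display) (T : measurableType d).

(* Integral of a Hilbert-valued map in the weak (Pettis) sense.  The vector
   [m] is unique when it exists; the value is 0 by convention otherwise. *)
Definition hilbert_mean (H : hilbert R) (P : {measure set T -> \bar R})
    (phi : T -> H) : H :=
  xget 0 [set m | forall h : H,
    P.-integrable setT (EFin \o (fun t => dotp h (phi t))) /\
    dotp h m = \int[P]_t dotp h (phi t)].

Definition mean_embedding (k : T -> T -> R) (H : rkhs k)
    (P : {measure set T -> \bar R}) : H :=
  hilbert_mean P (feature H).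

Definition mmd (k : T -> T -> R) (H : rkhs k)
    (P Q : {measure set T -> \bar R}) : R :=
  `|mean_embedding H P - mean_embedding H Q|.

End mean.

Definition opnorm (R : realType) (V W : normedModType R) (f : V -> W) : R :=
  sup [set `|f v| | v in [set v : V | `|v| <= 1]].

Definition cond_mean_embedding (R : realType) (S : Type) (d : measure_display)
    (T : measurableType d) (kS : S -> S -> R) (kT : T -> T -> R)
    (HS : rkhs kS) (HT : rkhs kT) (K : S -> probability T R) (C : HS -> HT) :=
  forall x, C (feature HS x) = mean_embedding HT (K x).

Section average_measure.
Local Open Scope ereal_scope.
Context (R : realType) (d : measure_display) (T : measurableType d) (n : nat).
Variable m : 'I_n -> {measure set T -> \bar R}.

Definition average_measure (A : set T) : \bar R :=
  (n%:R^-1)%:E * \sum_(i < n) m i A.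

Let average_measure0 : average_measure set0 = 0.
Proof. by rewrite /average_measure big1 ?mule0. Qed.

Let average_measure_ge0 A : 0 <= average_measure A.
Proof. by apply: mule_ge0; [rewrite lee_fin|apply: sume_ge0]. Qed.

Let average_measure_sigma_additive : semi_sigma_additive average_measure.
Proof.
pose m' (k : nat) : {measure set T -> \bar R} :=
  if insub k is Some i then m i else mzero.
have n0 : (0 <= n%:R^-1 :> R)%R by [].
have -> : average_measure = mscale (NngNum n0) (msum m' n).
  apply/funext => A; rewrite /average_measure /mscale /msum/=.
  by congr (_ * _); apply: eq_bigr => i _; rewrite /m' valK.
exact: measure_semi_sigma_additive.
Qed.

HB.instance Definition _ := isMeasure.Build _ _ _ average_measure
  average_measure0 average_measure_ge0 average_measure_sigma_additive.

End average_measure.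

Section empirical.
Context (R : realType) (d1 d2 : measure_display).
Context (S : measurableType d1) (T : measurableType d2).

Definition empirical_measure (n : nat) (z : 'I_n -> S * T) :=
  average_measure (fun i => \d_(z i) : {measure set (S * T) -> \bar R}).

Definition model_empirical_measure (K : S -> probability T R)
    (n : nat) (z : 'I_n -> S * T) :=
  average_measure (fun i =>
    (\d_((z i).1) \x K (z i).1)%E : {measure set (S * T) -> \bar R}).

HB.instance Definition _ :=
  isMeasurableFun.Build _ _ _ _ (@fst S T) measurable_fst.

Definition marginal1 (P : probability (S * T)%type R) : probability S R :=
  distribution P (@fst S T).

(* The rectangles determine [Q]. *)
Definition joint_law (PS : {measure set S -> \bar R})
    (K : S -> probability T R) (Q : probability (S * T)%type R) :=
  forall A B, measurable A -> measurable B ->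
    Q (A `*` B) = (\int[PS]_x ((\1_A x)%:E * K x B))%E.

End empirical.

Definition mmd_estimate (R : realType) (d1 d2 : measure_display)
    (S : measurableType d1) (T : measurableType d2)
    (k : S * T -> S * T -> R) (H : rkhs k)
    (Theta : Type) (K : Theta -> S -> probability T R)
    (n : nat) (z : 'I_n -> S * T) (th : Theta) :=
  forall th',
    mmd H (model_empirical_measure (K th) z) (empirical_measure R z) ^+ 2 <=
    mmd H (model_empirical_measure (K th') z) (empirical_measure R z) ^+ 2.

Definition contamination (R : realType) (T : Type) (eps : R) (n : nat)
    (z0 z : 'I_n -> T) :=
  exists I : {set 'I_n},
    #|I|%:R / n%:R <= eps /\ forall i, i \notin I -> z i = z0 i.

Section probability.
Local Open Scope ereal_scope.
Context (R : realType) (d : measure_display) (Om : measurableType d).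
Variable P : probability Om R.

Definition iid (dT : measure_display) (T : measurableType dT)
    (Q : probability T R) (I : finType) (Z : I -> {mfun Om >-> T}) :=
  (forall i A, measurable A -> distribution P (Z i) A = Q A) /\
  (forall (J : {set I}) (A : I -> set T), (forall i, measurable (A i)) ->
     P (\bigcap_(i in [set` J]) (Z i @^-1` A i)) =
     \prod_(i in J) P (Z i @^-1` A i)).

(* Upper integral of a nonnegative function and inner probability of a set.
   They are the expectation and the probability of measurable arguments
   ([outer_expectationE], [inner_probabilityE]) and stay meaningful when
   measurability is not known: nothing is assumed on the regularity of a
   parametric family in its parameter, so a quantity attached to a measurable
   random parameter need not be measurable. *)
Definition outer_expectation (X : Om -> R) : \bar R :=
  ereal_inf [set \int[P]_w Y w | Y in
    [set Y : Om -> \bar R | measurable_fun setT Y /\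
                            forall w, (X w)%:E <= Y w]].

Definition inner_probability (E : set Om) : \bar R :=
  ereal_sup [set P A | A in [set A | measurable A /\ A `<=` E]].

Lemma outer_expectationE (X : {RV P >-> R}) :
  (forall w, (0 <= X w)%R) -> outer_expectation X = 'E_P[X].
Proof.
move=> X0; rewrite unlock; apply/eqP; rewrite eq_le; apply/andP; split.
  by apply: ereal_inf_lbound; exists (EFin \o X) => //; split=> //;
    exact/measurable_EFinP.
apply: le_ereal_inf_tmp => _ [Y [mY XY] <-]; apply: ge0_le_integral => //.
- by move=> w _; rewrite lee_fin.
- exact/measurable_EFinP.
Qed.

Lemma inner_probabilityE (E : set Om) :
  measurable E -> inner_probability E = P E.
Proof.
move=> mE; apply/eqP; rewrite eq_le; apply/andP; split.
  apply: ge_ereal_sup => _ [A [mA AE] <-]; exact: (le_measure P (mem_set mA) (mem_set mE) AE).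
by apply: ereal_sup_ubound; exists E; split.
Qed.

End probability.

(* Main.v *)
(* Write E and M_theta for the empirical measure of the clean sample and for the
   model built on its covariates.  By the triangle inequality and minimality of
   thn, for every theta,
     D_k(P_thn, P0) <= 8 eps + D_k(P_theta, P0) + D_k(P_thn, M_thn)
                       + 2 D_k(E, P0) + D_k(P_theta, M_theta).
   The term with the random parameter is bounded uniformly: the kernel
   <psi x, psi x'> = kX(x, x') <C phi x, C phi x'> of the fibrewise embeddings is
   dominated by ||C||^2 kX^2 in the order of positive definite kernels (Schur
   product), so that term is at most frakC times the deviation of the empirical
   law of the covariates for the kernel kX^2.  Every deviation that is left has
   mean at most n^(-1/2) and satisfies McDiarmid's inequality.  The infimum over
   theta is not attained; the slack log(4/eta) > log(3/eta) pays for an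
   approximate minimizer and for the strict inequality. *)
Require Import Defs.
From HB Require Import structures.
From mathcomp Require Import all_boot all_order all_algebra.
From mathcomp Require Import all_classical all_reals all_analysis.
From mathcomp Require Import measurable_realfun ring lra.

Set Implicit Arguments.
Unset Strict Implicit.
Unset Printing Implicit Defensive.

Import Order.TTheory GRing.Theory Num.Theory.
Import numFieldNormedType.Exports.

Local Open Scope classical_set_scope.
Local Open Scope ring_scope.

(** * Positive definite kernels *)

(** Since [thn] depends on the sample, concentration at a fixed parameter says nothing about the
    model term at [thn]; this forces an inequality valid for every sample and every parameter at
    once, which the comparison of kernels provides. To make kernels comparable, a deviation is
    computed from Gram matrices alone: it is the square root of a quadratic form, evaluated at [P]
    minus the empirical measure, for the kernel extended by a point standing for [P]. Positivity of
    this extension is proved by sampling from [P], without a feature map, so that it applies to the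
    difference of two kernels, for which no Hilbert space is at hand. Deviations are then bounded
    measurable functions of the sample, and McDiarmid's inequality for them needs neither
    vector-valued integrals nor martingales: coordinates are averaged out one at a time.
    Hilbert-valued means serve to translate MMD norms into deviations; they exist by Riesz
    representation, from weak measurability only. *)

Section pd_forms.
Context (R : realType) (T : Type).
Implicit Types (k : T -> T -> R) (l m : seq (R * T)).

(** A list of weighted points stands for a finitely supported signed measure: concatenation is
    addition, [scalel] is scaling, and positivity can be proved by induction on the list. *)
Definition bform k l m : R := \sum_(p <- l) \sum_(q <- m) p.1 * q.1 * k p.2 q.2.

Definition scalel (a : R) l := [seq (a * p.1, p.2) | p <- l].

Lemma bform_nill k m : bform k [::] m = 0.
Proof. by rewrite /bform big_nil. Qed.

Lemma bform_catl k l l' m : bform k (l ++ l') m = bform k l m + bform k l' m.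
Proof. by rewrite /bform big_cat. Qed.

Lemma bform_catr k l m m' : bform k l (m ++ m') = bform k l m + bform k l m'.
Proof.
by rewrite /bform -big_split; apply: eq_bigr => p _; rewrite big_cat.
Qed.

Lemma bform_consl k p l m :
  bform k (p :: l) m = bform k [:: p] m + bform k l m.
Proof. by rewrite -cat1s bform_catl. Qed.

Lemma bform_consr k l p m :
  bform k l (p :: m) = bform k l [:: p] + bform k l m.
Proof. by rewrite -cat1s bform_catr. Qed.

Lemma bform1 k a x b y : bform k [:: (a, x)] [:: (b, y)] = a * b * k x y.
Proof. by rewrite /bform !big_seq1. Qed.

Lemma bform_scalel k a l m : bform k (scalel a l) m = a * bform k l m.
Proof.
rewrite /bform big_map mulr_sumr; apply: eq_bigr => p _ /=.
by rewrite mulr_sumr; apply: eq_bigr => q _; rewrite !mulrA.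
Qed.

Lemma bformC k l m : (forall x y, k x y = k y x) -> bform k l m = bform k m l.
Proof.
move=> kC; rewrite /bform exchange_big; apply: eq_bigr => p _.
by apply: eq_bigr => q _; rewrite kC (mulrC q.1).
Qed.

Lemma bform_ge0 k l : pd_kernel k -> 0 <= bform k l l.
Proof.
move=> [_ k0]; pose t := tnth (in_tuple l).
have := k0 _ (fun i => (t i).1) (fun i => (t i).2).
rewrite (_ : \sum_(i < _) _ = bform k l l) // /bform [RHS]big_tnth.
by apply: eq_bigr => i _; rewrite [RHS]big_tnth.
Qed.

Lemma pd_kernelP k : (forall x y, k x y = k y x) ->
  (forall l, 0 <= bform k l l) -> pd_kernel k.
Proof.
move=> kC k0; split=> // m c x.
have := k0 [seq (c i, x i) | i <- index_enum 'I_m].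
by rewrite /bform big_map; under eq_bigr do rewrite big_map.
Qed.

Lemma bform_CS k l m : pd_kernel k ->
  bform k l m ^+ 2 <= bform k l l * bform k m m.
Proof.
move=> pdk; have kC := pdk.1.
set a := bform k l l; set b := bform k l m; set c := bform k m m.
have pos x y : 0 <= x ^+ 2 * a + 2 * x * y * b + y ^+ 2 * c.
  have := bform_ge0 (scalel x l ++ scalel y m) pdk.
  rewrite bform_catl !bform_catr !bform_scalel !(bformC _ (scalel _ _)) //.
  rewrite !bform_scalel -/a -/c (bformC m l) // -/b.
  by congr (_ <= _); ring.
have a0 : 0 <= a by exact: bform_ge0.
have [a_eq0|a_neq0] := eqVneq a 0.
  rewrite a_eq0 mul0r; have [->|b_neq0] := eqVneq b 0; first by rewrite expr0n.
  (* With [a = 0] and [y = 1] the form is affine in [x]; this [x] gives it the value -1. *)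
  have := pos (- (c + 1) / (2 * b)) 1.
  suff -> : (- (c + 1) / (2 * b)) ^+ 2 * a + 2 * (- (c + 1) / (2 * b)) * 1 * b
    + 1 ^+ 2 * c = - 1 by lra.
  by rewrite a_eq0; field.
have a_gt0 : 0 < a by rewrite lt_neqAle eq_sym a_neq0.
(* The minimizing direction, cleared of denominators. *)
have := pos (- b) a.
have -> : (- b) ^+ 2 * a + 2 * - b * a * b + a ^+ 2 * c = a * (a * c - b ^+ 2).
  by ring.
by rewrite pmulr_rge0 // subr_ge0.
Qed.

Lemma pd_kernel_CS k x y : pd_kernel k -> k x y ^+ 2 <= k x x * k y y.
Proof. by move=> /(bform_CS [:: (1, x)] [:: (1, y)]); rewrite !bform1 !mul1r. Qed.

Lemma sqrt_bformD k l m : pd_kernel k ->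
  Num.sqrt (bform k (l ++ m) (l ++ m)) <=
  Num.sqrt (bform k l l) + Num.sqrt (bform k m m).
Proof.
move=> pdk; have l0 := bform_ge0 l pdk; have m0 := bform_ge0 m pdk.
rewrite -[leRHS]ger0_norm ?addr_ge0 ?sqrtr_ge0 // -sqrtr_sqr ler_wsqrtr //.
rewrite sqrrD !sqr_sqrtr // bform_catl !bform_catr (bformC m l); last exact: pdk.1.
have : bform k l m <= Num.sqrt (bform k l l) * Num.sqrt (bform k m m).
  rewrite -sqrtrM // (le_trans (ler_norm _)) // -sqrtr_sqr ler_wsqrtr //.
  exact: bform_CS.
by lra.
Qed.

Lemma bformBk k k' (a : R) l :
  bform (fun x y => a * k x y - k' x y) l l = a * bform k l l - bform k' l l.
Proof.
rewrite /bform mulr_sumr -sumrB; apply: eq_bigr => p _.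
rewrite mulr_sumr -sumrB; apply: eq_bigr => q _.
by rewrite mulrBr mulrCA.
Qed.

(** This is the Gram kernel of the features projected off that of [z]: on a list the form loses
    [s ^+ 2 / k z z], which Cauchy-Schwarz bounds by the form itself. If [k z z = 0], the inverse is
    0 and nothing is subtracted. *)
Lemma pd_kernel_schur_complement k z : pd_kernel k ->
  pd_kernel (fun x y => k x y - k x z * k z y / k z z).
Proof.
move=> pdk; have kC := pdk.1; apply: pd_kernelP => [x y|l].
  by rewrite (kC x y) (kC x z) (kC y z) (mulrC (k z x)).
pose s := bform k l [:: (1, z)].
have -> : bform (fun x y => k x y - k x z * k z y / k z z) l l =
    bform k l l - s ^+ 2 / k z z.
  rewrite expr2 {2}/s (bformC _ [:: _]) // /s /bform.
  rewrite big_seq1 mulr_suml mulr_suml -sumrB; apply: eq_bigr => p _.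
  rewrite big_seq1 mulr_sumr mulr_suml -sumrB; apply: eq_bigr => q _ /=.
  by rewrite mulrBr; congr (_ - _); ring.
have [kz0|kz_neq0] := eqVneq (k z z) 0.
  by rewrite kz0 invr0 mulr0 subr0 bform_ge0.
have kz_gt0 : 0 < k z z.
  rewrite lt_neqAle eq_sym kz_neq0 /=.
  by have := bform_ge0 [:: (1, z)] pdk; rewrite bform1 !mul1r.
rewrite subr_ge0 ler_pdivrMr //.
by have := bform_CS l [:: (1, z)] pdk; rewrite bform1 !mul1r.
Qed.

(* Peel off the first point of [l]: the rank-one part of [k] is a reweighting
   of [l], and the Schur complement vanishes at that point. *)
Lemma pd_kernelM k k' : pd_kernel k -> pd_kernel k' ->
  pd_kernel (fun x y => k x y * k' x y).
Proof.
move=> pdk pdk'; apply: pd_kernelP => [x y|l].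
  by rewrite pdk.1 pdk'.1.
elim: l k pdk => [|[c z] l IH] k pdk; first by rewrite bform_nill.
have kC := pdk.1; have k'C := pdk'.1.
pose k1 x y := k x y - k x z * k z y / k z z.
have pdk1 : pd_kernel k1 by exact: pd_kernel_schur_complement.
have kzz : 0 <= k z z.
  by have := bform_ge0 [:: (1, z)] pdk; rewrite bform1 !mul1r.
have k1z y : k1 z y = 0.
  have [kz0|kz_neq0] := eqVneq (k z z) 0; last first.
    by rewrite /k1 mulrAC divff// mul1r subrr.
  rewrite /k1 kz0 invr0 mulr0 subr0; apply/eqP.
  by have := pd_kernel_CS z y pdk; rewrite kz0 mul0r -sqrf_eq0 eq_le sqr_ge0 => ->.
have split_k l' : bform (fun x y => k x y * k' x y) l' l' =
    (k z z)^-1 * bform k' [seq (p.1 * k p.2 z, p.2) | p <- l']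
                         [seq (p.1 * k p.2 z, p.2) | p <- l']
    + bform (fun x y => k1 x y * k' x y) l' l'.
  rewrite /bform big_map mulr_sumr -big_split; apply: eq_bigr => p _ /=.
  rewrite big_map mulr_sumr -big_split; apply: eq_bigr => q _ /=.
  by rewrite (kC q.2) /k1; ring.
rewrite split_k addr_ge0 //; first by rewrite mulr_ge0 ?invr_ge0 ?bform_ge0.
rewrite bform_consl !(bform_consr _ _ _ l) bform1 /= k1z !(mul0r, mulr0, add0r).
rewrite (_ : bform _ _ _ = 0) ?add0r; last first.
  by rewrite /bform big_seq1 big1 // => q _ /=; rewrite k1z mul0r mulr0.
rewrite (_ : bform _ _ _ = 0) ?add0r; first exact: IH.
by rewrite /bform big1 // => q _; rewrite big_seq1 /= pdk1.1 k1z mul0r mulr0.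
Qed.

Lemma pd_kernel0 : pd_kernel (fun _ _ : T => 0 : R).
Proof.
by split=> // m c x; rewrite big1// => i _; rewrite big1// => j _; rewrite mulr0.
Qed.

End pd_forms.

Lemma pd_kernel_comp (R : realType) (S T : Type) (f : S -> T) (k : T -> T -> R) :
  pd_kernel k -> pd_kernel (fun x y => k (f x) (f y)).
Proof. by move=> [kC k0]; split=> // m c x; exact: (k0 m c (f \o x)). Qed.

(** * Bounded measurable functions *)

(** A class of integrands stable under algebra, [expR], square roots and partial integration, and
    integrable for every probability, so that integrability never needs an argument of its own. *)
Definition bounded_measurable (R : realType) d (T : measurableType d)
    (f : T -> R) :=
  measurable_fun setT f /\ exists M, forall t, `|f t| <= M.

Lemma probability_lty (R : realType) d (T : measurableType d)
    (P : probability T R) : ((P : {measure set T -> \bar R}) setT < +oo)%E.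
Proof. by rewrite [ltLHS](probability_setT P) ltry. Qed.

Section bounded_measurable.
Context (R : realType) d (T : measurableType d).
Implicit Types f g : T -> R.
Local Notation bm := (@bounded_measurable R d T).

Lemma bm_cst (c : R) : bm (fun=> c).
Proof. by split; [exact: measurable_cst|exists `|c|]. Qed.

Lemma bmD f g : bm f -> bm g -> bm (fun t => f t + g t).
Proof.
move=> [mf [M fM]] [mg [N gN]]; split; first exact: measurable_funD.
by exists (M + N) => t; rewrite (le_trans (ler_normD _ _)) // lerD.
Qed.

Lemma bmM f g : bm f -> bm g -> bm (fun t => f t * g t).
Proof.
move=> [mf [M fM]] [mg [N gN]]; split; first exact: measurable_funM.
by exists (M * N) => t; rewrite normrM ler_pM.
Qed.

Lemma bmZ (c : R) f : bm f -> bm (fun t => c * f t).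
Proof. exact: bmM (bm_cst c). Qed.

Lemma bmN f : bm f -> bm (fun t => - f t).
Proof. by move=> /(bmZ (-1)); under eq_fun do rewrite mulN1r. Qed.

Lemma bmB f g : bm f -> bm g -> bm (fun t => f t - g t).
Proof. by move=> bf /bmN; exact: bmD. Qed.

Lemma bm_sum (I : Type) (r : seq I) (F : I -> T -> R) :
  (forall i, bm (F i)) -> bm (fun t => \sum_(i <- r) F i t).
Proof.
move=> bF; elim: r => [|i r IH].
  by under eq_fun do rewrite big_nil; exact: bm_cst.
by under eq_fun do rewrite big_cons; exact: bmD.
Qed.

Lemma bm_comp d' (S : measurableType d') f (h : S -> T) :
  bm f -> measurable_fun setT h -> bounded_measurable (fun s => f (h s)).
Proof.
move=> [mf [M fM]] mh; split; first exact: measurableT_comp mf mh.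
by exists M.
Qed.

Lemma bm_continuous_comp (h : R -> R) f : bm f -> continuous h ->
  (forall M : R, exists N, forall x, `|x| <= M -> `|h x| <= N) ->
  bm (fun t => h (f t)).
Proof.
move=> [mf [M fM]] hc hb; split.
  by apply: measurableT_comp mf; exact: continuous_measurable_fun hc.
by have [N hN] := hb M; exists N => t; exact: hN.
Qed.

Lemma bm_expR f : bm f -> bm (fun t => expR (f t)).
Proof.
move=> bf; apply: (bm_continuous_comp bf) => [|M]; first exact: continuous_expR.
exists (expR M) => x xM; rewrite ger0_norm ?expR_ge0 // ler_expR.
exact: le_trans (ler_norm x) xM.
Qed.

Lemma bm_sqrt f : bm f -> bm (fun t => Num.sqrt (f t)).
Proof.
move=> bf; apply: (bm_continuous_comp bf) => [|M]; first exact: sqrt_continuous.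
exists (Num.sqrt M) => x xM; rewrite ger0_norm ?sqrtr_ge0 // ler_wsqrtr //.
exact: le_trans (ler_norm x) xM.
Qed.

Lemma bm_integrable (mu : {measure set T -> \bar R}) f :
  (mu setT < +oo)%E -> bm f -> mu.-integrable setT (EFin \o f).
Proof.
move=> muT [mf [M fM]]; apply: measurable_bounded_integrable => //.
exists M; split; first by rewrite num_real.
by move=> N MN t _ /=; rewrite (le_trans (fM t)) // ltW.
Qed.

Variable P : probability T R.

Lemma bm_integrableP f : bm f -> P.-integrable setT (EFin \o f).
Proof.
by move=> bf; apply: bm_integrable bf; exact: probability_lty.
Qed.

Lemma mean_cst (c : R) : \int[P]_t c = c.
Proof.
by rewrite Rintegral_cst // [X in fine X](probability_setT P) mulr1.
Qed.

Lemma meanD f g : bm f -> bm g ->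
  \int[P]_t (f t + g t) = \int[P]_t f t + \int[P]_t g t.
Proof. by move=> bf bg; apply: RintegralD => //; exact: bm_integrableP. Qed.

Lemma meanZ (c : R) f : bm f -> \int[P]_t (c * f t) = c * \int[P]_t f t.
Proof. by move=> bf; apply: RintegralZl => //; exact: bm_integrableP. Qed.

Lemma meanB f g : bm f -> bm g ->
  \int[P]_t (f t - g t) = \int[P]_t f t - \int[P]_t g t.
Proof. by move=> bf bg; apply: RintegralB => //; exact: bm_integrableP. Qed.

Lemma mean_sum (I : Type) (r : seq I) (F : I -> T -> R) :
  (forall i, bm (F i)) ->
  \int[P]_t (\sum_(i <- r) F i t) = \sum_(i <- r) \int[P]_t F i t.
Proof.
move=> bF; elim: r => [|i r IH].
  rewrite big_nil -[RHS](mean_cst 0); congr (Rintegral _ _ _).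
  by apply/funext => t; rewrite big_nil.
rewrite big_cons -IH -meanD //; last exact: bm_sum.
by congr (Rintegral _ _ _); apply/funext => t; rewrite big_cons.
Qed.

Lemma le_mean f g : bm f -> bm g -> (forall t, f t <= g t) ->
  \int[P]_t f t <= \int[P]_t g t.
Proof. by move=> bf bg fg; apply: le_Rintegral => //; exact: bm_integrableP. Qed.

Lemma normr_mean_le (M : R) f : bm f -> (forall t, `|f t| <= M) ->
  `|\int[P]_t f t| <= M.
Proof.
move=> bf fM; rewrite ler_norml -[- M]mean_cst -{2}[M]mean_cst.
by apply/andP; split; apply: le_mean => //; try exact: bm_cst;
  move=> t; move: (fM t); rewrite ler_norml => /andP[].
Qed.

(* A bounded function cannot exceed its mean by a fixed amount everywhere; the
   slack avoids discussing strict monotonicity of the integral. *)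
Lemma le_mean_witness (c : R) f : 0 < c -> bm f ->
  exists t, f t <= \int[P]_t f t + c.
Proof.
move=> c0 bf; apply: contrapT => /forallNP nf.
have : \int[P]_t (\int[P]_t f t + c) <= \int[P]_t f t.
  apply: le_mean => //; first exact: bm_cst.
  by move=> t; move/negP: (nf t); rewrite -ltNge => /ltW.
by rewrite mean_cst gerDl leNgt c0.
Qed.

End bounded_measurable.

(** * Probability kernels, iterated integrals and disintegration *)

Section kfam.
Context (R : realType) d1 d2 (S : measurableType d1) (T : measurableType d2).
Variable K : S -> probability T R.
Hypothesis mK : forall U, measurable U -> measurable_fun setT (fun s => K s U).

(** Carrying the measurability proof inside the term lets the kernel structures be attached to
    [kfam mK]. *)
Definition kfam (h : forall U, measurable U ->
  measurable_fun setT (fun s => K s U)) : S -> {measure set T -> \bar R} := K.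

HB.instance Definition _ := isKernel.Build _ _ _ _ R (kfam mK) mK.

Let kfam1 s : kfam mK s setT = 1%E.
Proof. exact: probability_setT. Qed.

HB.instance Definition _ :=
  Kernel_isProbability.Build _ _ _ _ _ (kfam mK) kfam1.

End kfam.

Section sections.
Context (R : realType) d1 d2 (S : measurableType d1) (T : measurableType d2).
Variable f : S * T -> R.
Hypothesis bf : bounded_measurable f.

Lemma bm_pair1 s : bounded_measurable (fun t => f (s, t)).
Proof. by apply: (bm_comp bf); exact: pair1_measurable. Qed.

Lemma EFin_mean (P : probability T R) (g : T -> R) : bounded_measurable g ->
  (\int[P]_t g t)%:E = (\int[P]_t (g t)%:E)%E.
Proof.
move=> bg; rewrite /Rintegral fineK //.
by apply: integrable_fin_num => //; exact: bm_integrableP.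
Qed.

Lemma bm_mean_kernel (K : S -> probability T R) :
  (forall U, measurable U -> measurable_fun setT (fun s => K s U)) ->
  bounded_measurable (fun s => \int[K s]_t f (s, t)).
Proof.
move=> mK; have [mf [M fM]] := bf; split; last first.
  by exists M => s; apply: normr_mean_le => //; exact: bm_pair1.
(* The shift by the bound [M] makes the integrand nonnegative, as the measurability result for
   kernel integrals asks; it comes off again because [K s] has mass 1. *)
rewrite (_ : (fun s => _) = fun s => \int[K s]_t (f (s, t) + M) - M); last first.
  apply/funext => s; rewrite meanD ?mean_cst ?addrK //; first exact: bm_pair1.
  exact: bm_cst.
apply: measurable_funB => //.
have bfM : bounded_measurable (fun z => f z + M) by exact: (bmD bf (bm_cst _ _)).
apply/measurable_EFinP.
rewrite (_ : _ \o _ = fun s => (\int[kfam mK s]_t (f (s, t) + M)%:E)%E); last first.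
  apply/funext => s /=; rewrite EFin_mean //.
  by apply: (bmD _ (bm_cst _ _)); exact: bm_pair1.
apply: (measurable_fun_integral_finite_kernel (fun z => (f z + M)%:E)) => [z|].
  by rewrite lee_fin -lerBlDr sub0r; have := fM z; rewrite ler_norml => /andP[].
by apply/measurable_EFinP; exact: bfM.1.
Qed.

Lemma bm_mean (P : probability T R) :
  bounded_measurable (fun s => \int[P]_t f (s, t)).
Proof. by apply: bm_mean_kernel => U mU; exact: measurable_cst. Qed.

Lemma mean_prod (P : probability S R) (Q : probability T R) :
  \int[(P \x Q)%E]_z f z = \int[P]_s \int[Q]_t f (s, t).
Proof.
rewrite /Rintegral -integral12_prod_meas1 /=; last exact: bm_integrableP.
congr fine; apply: eq_integral => s _; rewrite /fubini_F /= -EFin_mean //.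
exact: bm_pair1.
Qed.

End sections.

Lemma rectangle_measure_unique (R : realType) d1 d2 (S : measurableType d1)
    (T : measurableType d2) (m1 m2 : {measure set (S * T) -> \bar R}) :
  (m1 setT < +oo)%E ->
  (forall A B, measurable A -> measurable B -> m1 (A `*` B) = m2 (A `*` B)) ->
  forall A, measurable A -> m1 A = m2 A.
Proof.
move=> m1T m12 A mA.
apply: (measure_unique [set C | exists2 U, measurable U &
  exists2 V, measurable V & U `*` V = C] (fun=> setT)) => //.
- exact: measurable_prod_measurableType.
- move=> _ _ [U1 mU1 [V1 mV1 <-]] [U2 mU2 [V2 mV2 <-]].
  rewrite -setXI; exists (U1 `&` U2); first exact: measurableI.
  by exists (V1 `&` V2) => //; exact: measurableI.
- by move=> _; exists setT => //; exists setT => //; rewrite setXTT.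
- by apply/seteqP; split=> // z _; exists 0%N.
- by move=> _ [U mU [V mV <-]]; exact: m12.
Qed.

Section disintegration.
Context (R : realType) d1 d2 (S : measurableType d1) (T : measurableType d2).
Variables (P : probability S R) (K : S -> probability T R).
Variable Q : probability (S * T)%type R.
Hypothesis mK : forall U, measurable U -> measurable_fun setT (fun s => K s U).
Hypothesis QE : joint_law P K Q.

(** With [P] seen as a kernel out of [unit], composing it with [s |-> \d_s \x K s] gives a measure
    that agrees with [Q] on rectangles, hence everywhere. The integral against a composition is
    iterated, and the Dirac factor then collapses. *)
Let D (u : unit * S) : probability (S * T)%type R :=
  (\d_(u.2) \x K u.2)%E : probability (S * T)%type R.

Let DE u A : measurable A -> D u A = K u.2 (xsection A u.2).
Proof.
move=> mA; rewrite /D /= /product_measure1 integral_dirac //; last first.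
  exact: measurable_fun_xsection.
by rewrite diracT mul1e.
Qed.

Let mD A : measurable A -> measurable_fun setT (fun u => D u A).
Proof.
move=> mA; under eq_fun do rewrite DE //.
apply: (measurableT_comp (f := fun s => kfam mK s (xsection A s))) => //.
by apply: measurable_fun_xsection_finite_kernel; rewrite inE.
Qed.

Let mP U : measurable U -> measurable_fun setT (fun _ : unit => P U).
Proof. by move=> mU; exact: measurable_cst. Qed.

Let QkE A : measurable A -> Q A = kcomp (kfam mP) (kfam mD) tt A.
Proof.
apply: rectangle_measure_unique; first exact: probability_lty.
move=> U V mU mV; rewrite [LHS](QE mU mV); apply: eq_integral => s _.
by rewrite /kfam /D /= product_measure1E // diracE indicE.
Qed.

Lemma mean_disintegration (f : S * T -> R) : bounded_measurable f ->
  \int[Q]_z f z = \int[P]_s \int[K s]_t f (s, t).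
Proof.
move=> bf; have [mf [M fM]] := bf.
have bfM : bounded_measurable (fun z => f z + M) by exact: (bmD bf (bm_cst _ _)).
suff : \int[Q]_z (f z + M) = \int[P]_s \int[K s]_t (f (s, t) + M).
  rewrite meanD // ?mean_cst; last exact: bm_cst.
  rewrite (_ : (fun s => _) = fun s => \int[K s]_t f (s, t) + M); last first.
    apply/funext => s; rewrite meanD ?mean_cst //; first exact: bm_pair1.
    exact: bm_cst.
  rewrite meanD ?mean_cst; [exact: addIr| |exact: bm_cst].
  exact: bm_mean_kernel.
have fM0 z : (0 <= (f z + M)%:E)%E.
  by rewrite lee_fin -lerBlDr sub0r; have := fM z; rewrite ler_norml => /andP[].
rewrite /Rintegral; congr fine.
rewrite (eq_measure_integral (kcomp (kfam mP) (kfam mD) tt)); last first.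
  by move=> A mA _; exact: QkE.
rewrite integral_kcomp //; last by apply/measurable_EFinP; exact: bfM.1.
apply: eq_integral => s _; rewrite -EFin_mean; last exact: bfM.
rewrite (mean_prod bfM) /Rintegral integral_dirac //= ?diracT ?mul1e.
  by rewrite indicT mul1r.
by apply/measurable_EFinP; exact: (bm_mean bfM (K s)).1.
Qed.

End disintegration.

(** * The kernel extended by a probability measure *)

(* [None] stands for the probability [P]: the Gram matrix of the embeddings of
   [P] and of the Dirac masses. *)
Definition kext (R : realType) d (T : measurableType d) (P : probability T R)
    (k : T -> T -> R) (x y : option T) : R :=
  match x, y with
  | Some s, Some t => k s t
  | Some s, None => \int[P]_t k s t
  | None, Some t => \int[P]_s k t s
  | None, None => \int[P]_s \int[P]_t k s t
  end.

Section kext.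
Context (R : realType) d (T : measurableType d) (P : probability T R).
Variable k : T -> T -> R.
Hypothesis pdk : pd_kernel k.
Hypothesis mk : measurable_fun setT (fun z : T * T => k z.1 z.2).
Variable M : R.
Hypothesis kM : forall s t, `|k s t| <= M.

Local Notation K := (kext P k).
Implicit Types l : seq (R * option T).

Let bk : bounded_measurable (fun z : T * T => k z.1 z.2).
Proof. by split => //; exists M => z; exact: kM. Qed.

Lemma bm_kext x : bounded_measurable (fun t => K x (Some t)).
Proof.
case: x => [s|] /=; first exact: (bm_pair1 bk s).
exact: (bm_mean bk P).
Qed.

Lemma mean_kext x : \int[P]_t K x (Some t) = K x None.
Proof. by case: x. Qed.

Lemma kextC x y : K x y = K y x.
Proof. by case: x y => [s|] [t|] //=; exact: pdk.1. Qed.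

Lemma bm_kext_diag : bounded_measurable (fun t => k t t).
Proof.
apply: (bm_comp bk (h := fun t => (t, t))).
by apply: measurable_fun_pair; exact: measurable_id.
Qed.

Let none_weight l := \sum_(p <- l | ~~ p.2) p.1.

Fixpoint some_part l : seq (R * option T) :=
  match l with
  | [::] => [::]
  | (c, Some t) :: l' => (c, Some t) :: some_part l'
  | (_, None) :: l' => some_part l'
  end.

Let bform_split l m :
  bform K l m = none_weight l * bform K [:: (1, None)] m + bform K (some_part l) m.
Proof.
elim: l => [|[c [t|]] l IH] /=.
- by rewrite /none_weight /bform !big_nil mul0r addr0.
- rewrite bform_consl IH (bform_consl K (c, Some t) (some_part l)).
  by rewrite /none_weight big_cons /= addrCA.
- rewrite bform_consl IH /none_weight big_cons /= mulrDl addrA.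
  congr (_ + _ + _); rewrite /bform !big_seq1 mulr_sumr; apply: eq_bigr => q _.
  by rewrite /= !mulrA mulr1.
Qed.

Let bform_some_ge0 l : 0 <= bform K (some_part l) (some_part l).
Proof.
suff -> : some_part l =
    [seq (p.1, Some p.2) | p <- pmap (fun p => omap (pair p.1) p.2) l].
  rewrite /bform big_map; under eq_bigr do rewrite big_map.
  exact: bform_ge0.
by elim: l => [//|[c [t|]] l /= ->].
Qed.

Let bform_weight0 l : none_weight l = 0 -> 0 <= bform K l l.
Proof.
move=> l0; rewrite bform_split l0 mul0r add0r (bformC _ _ kextC).
by rewrite bform_split l0 mul0r add0r.
Qed.

(* Replacing the mass [c] of [P] by a Dirac mass at a random point with law [P]
   increases the form by at most [2 * M * c ^+ 2] on average. *)
Let sample_step l (c : R) : exists s,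
  bform K [:: (c, None), (- c, Some s) & l] [:: (c, None), (- c, Some s) & l]
  <= bform K l l + (2 * M * c ^+ 2 + 1).
Proof.
pose h t := \sum_(p <- l) p.1 * K p.2 (Some t).
pose v := \sum_(p <- l) p.1 * K p.2 None.
have bh : bounded_measurable h by apply: bm_sum => p; exact/bmZ/bm_kext.
have hv : \int[P]_t h t = v.
  rewrite /h mean_sum; last by move=> p; exact/bmZ/bm_kext.
  by apply: eq_bigr => p _; rewrite meanZ ?mean_kext //; exact: bm_kext.
have bl x : bform K l [:: (c, x)] = c * \sum_(p <- l) p.1 * K p.2 x.
  by rewrite /bform mulr_sumr; apply: eq_bigr => p _; rewrite big_seq1 /=; ring.
pose f t := bform K l l + 2 * c * v - 2 * c * h t +
  c ^+ 2 * (K None None - 2 * K None (Some t) + k t t).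
have fE s : bform K [:: (c, None), (- c, Some s) & l]
    [:: (c, None), (- c, Some s) & l] = f s.
  rewrite /f; set A := [:: _, _ & l]; have KC := kextC.
  rewrite /A bform_consl (bform_consl _ _ l).
  rewrite !(bform_consr _ _ _ [:: _ & l]) !(bform_consr _ _ _ l).
  rewrite !(bformC [:: _] l KC) !bform1 /=.
  have -> : bform K l [:: (- c, Some s)] = - c * h s.
    rewrite /bform /h mulr_sumr; apply: eq_bigr => p _; rewrite big_seq1 /=; ring.
  rewrite bl -/v /=; ring.
have bf : bounded_measurable f.
  apply: bmD; last first.
    apply: bmZ; apply: bmD; last exact: bm_kext_diag.
    by apply: bmB; [exact: bm_cst|apply: bmZ; exact: (bm_kext None)].
  by apply: bmB; [exact: bm_cst|exact: bmZ].
(* The slack 1 taken here is the [+ 1] of the statement. *)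
have [s fs] := le_mean_witness P ltr01 bf.
exists s; rewrite fE (le_trans fs) // addrA lerD2r.
have b1 : bounded_measurable (fun t => K None None - 2 * K None (Some t)).
  by apply: bmB; [exact: bm_cst|apply: bmZ; exact: (bm_kext None)].
(* The terms linear in [c] cancel since [h] has mean [v]; what remains is [c ^+ 2] times a
   difference of two numbers bounded by [M]. *)
have -> : \int[P]_t f t = bform K l l + c ^+ 2 * (\int[P]_t k t t - K None None).
  rewrite /f meanD; last 2 first.
  - by apply: bmB; [exact: bm_cst|exact: bmZ].
  - by apply: bmZ; apply: bmD => //; exact: bm_kext_diag.
  rewrite meanB ?mean_cst; last 2 first.
  - exact: bm_cst.
  - exact: bmZ.
  rewrite meanZ // hv meanZ; last by apply: bmD => //; exact: bm_kext_diag.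
  rewrite meanD //; last exact: bm_kext_diag.
  rewrite meanB ?mean_cst; last 2 first.
  - exact: bm_cst.
  - by apply: bmZ; exact: (bm_kext None).
  rewrite meanZ; last exact: (bm_kext None).
  by rewrite mean_kext; ring.
rewrite lerD2l mulrC ler_wpM2r ?sqr_ge0 //.
have := normr_mean_le P bm_kext_diag (fun t => kM t t).
have : `|K None None| <= M.
  apply: normr_mean_le; first exact: (bm_mean bk P).
  by move=> s'; apply: normr_mean_le => //; exact: (bm_pair1 bk s').
rewrite !ler_norml => /andP[? ?] /andP[? ?]; lra.
Qed.

(** A form without mass on [None] is a Gram form of [k]. Scale [l] by [n] and move its mass [n * a]
    on [None] to sampled points in [n] portions of size [a], each at a cost at most [B], which does
    not depend on [n]. The result has no mass on [None], so [0 <= n ^ 2 * q + n * B] for every [n],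
    where [q] is the form at [l]; the quadratic growth in [n] excludes [q < 0]. *)
Lemma pd_kext : pd_kernel K.
Proof.
apply: pd_kernelP; first exact: kextC.
move=> l; pose a := none_weight l; pose B := 2 * M * a ^+ 2 + 1.
have iter_step n l' : exists l'', none_weight l'' = none_weight l' + n%:R * (- a)
    /\ bform K l'' l'' <= bform K l' l' + n%:R * B.
  elim: n => [|n [l'' [w le_l'']]]; first by exists l'; rewrite !mul0r !addr0.
  have [s le_s] := sample_step l'' (- a).
  exists [:: (- a, None), (- - a, Some s) & l'']; split.
    by rewrite [LHS]/none_weight !big_cons /= -/(none_weight _) w -natr1; ring.
  by move: le_s le_l''; rewrite sqrrN -/B -natr1 mulrDl mul1r; lra.
have key n : 0 <= n%:R ^+ 2 * bform K l l + n%:R * B.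
  have [l'' [w le_l'']] := iter_step n (scalel n%:R l).
  have w0 : none_weight l'' = 0.
    by rewrite w /none_weight big_map -mulr_sumr -/a mulrN subrr.
  move: le_l''; rewrite bform_scalel bformC ?bform_scalel ?mulrA -?expr2.
    by move/(le_trans _); apply; exact: bform_weight0.
  exact: kextC.
rewrite leNgt; apply/negP => q0.
pose n := (Num.truncn (B / - bform K l l)).+1.
have nq : B / - bform K l l < n%:R by exact: truncnS_gt.
move: nq; rewrite ltr_pdivrMr ?oppr_gt0 // mulrN -subr_gt0 => nq.
have n0 : 0 < n%:R :> R by rewrite ltr0n.
have := key n; rewrite expr2 -mulrA -mulrDr pmulr_rge0 //; lra.
Qed.

End kext.

(** * Bounded differences *)

Section hoeffding.
Context (R : realType).

Lemma nondecreasing_from0 (f df : R -> R) :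
  (forall x, is_derive x (1 : R) f (df x)) -> (forall x, 0 <= x -> 0 <= df x) ->
  forall x, 0 <= x -> f 0 <= f x.
Proof.
move=> fdf df0 x; rewrite le_eqVlt => /predU1P[<-//|x0].
have [|c] := @MVT R f df 0 x x0 (fun y _ => fdf y).
  apply: continuous_subspaceT => y; apply: differentiable_continuous.
  by apply/derivable1_diffP; apply: ex_derive; exact: fdf.
rewrite in_itv /= subr0 => /andP[c0 _] fE.
by rewrite -subr_ge0 fE mulr_ge0 ?df0 // ltW.
Qed.

Variable p : R.
Hypothesis p01 : 0 <= p <= 1.

(** Moment generating function of a Bernoulli variable of parameter [p]. Its logarithmic derivative
    [u] is the mean under the exponentially tilted law, and [u' = u * (1 - u)] is the tilted
    variance. *)
Let D (h : R) : R := 1 - p + p * expR h.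
Let u (h : R) : R := p * expR h * (D h)^-1.

Let D_gt0 h : 0 < D h.
Proof.
case/andP: p01 => p0 p1; have [pE|p_neq0] := eqVneq p 0.
  by rewrite /D pE mul0r addr0 subr0.
have : 0 < p * expR h by rewrite mulr_gt0 ?expR_gt0 // lt_neqAle eq_sym p_neq0.
by rewrite /D; lra.
Qed.

Let dD h : is_derive h (1 : R) D (p * expR h).
Proof.
have H := is_deriveD (is_derive_cst (1 - p : R) h 1)
  (is_deriveZ p (is_derive_expR h)).
by apply: (is_derive_eq H); rewrite add0r.
Qed.

Let du h : is_derive h (1 : R) u (u h * (1 - u h)).
Proof.
have D0 : D h != 0 by rewrite gt_eqF.
have H := is_deriveM (is_deriveZ p (is_derive_expR h)) (is_deriveV D0 (dD h)).
apply: (is_derive_eq H); rewrite /= /GRing.scale /= /u.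
by set e := D h in D0 *; field.
Qed.

(** The tilted variance is at most 1/4, because [1/4 - u * (1 - u)] is a square. Integrating twice
    from 0 gives the term [h ^+ 2 / 8]: [g] is the gap between the logarithms, [g1] its derivative,
    and both vanish at 0. *)
Lemma bernoulli_mgf_le h : 0 <= h ->
  1 - p + p * expR h <= expR (p * h + h ^+ 2 / 8).
Proof.
move=> h0; rewrite -ler_ln ?posrE ?expR_gt0 //; last exact: D_gt0.
rewrite expRK -/(D h) -subr_ge0.
pose g1 x := x / 4 + p - u x.
pose g x := p * x + x ^+ 2 / 8 - ln (D x).
have dg1 x : is_derive x (1 : R) g1 (4^-1 - u x * (1 - u x)).
  have H := is_deriveB (is_deriveD (is_deriveZ (4^-1 : R) (is_derive_id x 1))
    (is_derive_cst p x 1)) (du x).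
  rewrite (_ : g1 = (4^-1 \*: id) + cst p - u).
    by apply: (is_derive_eq H); rewrite /GRing.scale /= addr0 mulr1.
  by apply/funext => y; rewrite /g1 mulrC.
have g1_ge0 x : 0 <= x -> 0 <= g1 x.
  have {2}<- : g1 0 = 0.
    by rewrite /g1 /u /D expR0; field; rewrite subrK oner_neq0.
  move=> x0; apply: (nondecreasing_from0 dg1) => // y _.
  have : 0 <= (u y - 2^-1) ^+ 2 by exact: sqr_ge0.
  by lra.
have dg x : is_derive x (1 : R) g (g1 x).
  have H := is_deriveB (is_deriveD (is_deriveZ p (is_derive_id x 1))
    (is_deriveZ (8^-1 : R) (is_deriveX 2 (is_derive_id x 1))))
    (is_derive1_comp (is_derive1_ln (D_gt0 x)) (dD x)).
  rewrite (_ : g = (p \*: id) + (8^-1 \*: (id ^+ 2)) - (@ln R \o D)).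
    apply: (is_derive_eq H); rewrite /GRing.scale /= /g1 /u.
    by rewrite expr1 !mulr1; congr (_ - _); last exact: mulrC; field.
  by apply/funext => y; rewrite /g [y ^+ 2 / 8]mulrC.
have <- : g 0 = 0.
  by rewrite /g /D expR0 mulr0 expr0n /= mul0r addr0 mulr1 subrK ln1 subrr.
exact: (nondecreasing_from0 dg g1_ge0).
Qed.

End hoeffding.

(** The tangent line at [u * c] lies below [expR] at [c] and at 0; in the average of these two
    bounds with weights [u] and [1 - u] the slopes cancel. *)
Lemma expR_chord (R : realType) (c u : R) : 0 <= u <= 1 ->
  expR (u * c) <= 1 - u + u * expR c.
Proof.
move=> /andP[u0 u1].
have e1 : expR (u * c) * (1 + (1 - u) * c) <= expR c.
  have {3}-> : c = u * c + (1 - u) * c by ring.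
  by rewrite expRD ler_wpM2l ?expR_ge0 ?expR_ge1Dx.
have e0 : expR (u * c) * (1 - u * c) <= 1.
  have {2}<- : expR (u * c) * expR (- (u * c)) = 1 by rewrite -expRD subrr expR0.
  by rewrite ler_wpM2l ?expR_ge0 ?expR_ge1Dx.
have := ler_wpM2l u0 e1.
have := ler_wpM2l (_ : 0 <= 1 - u) e0; rewrite subr_ge0 => /(_ u1).
set E := expR (u * c).
have -> : u * (E * (1 + (1 - u) * c)) = E - (1 - u) * (E * (1 - u * c)) by ring.
by lra.
Qed.

(** The values of [f] lie in [[a, a + c]] with [a] the infimum. Bounding [expR] by its chord there
    replaces [f] by a two-valued variable of the same mean, that is, a Bernoulli variable of
    parameter [(m - a) / c]. *)
Lemma hoeffding_lemma (R : realType) d (T : measurableType d)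
    (P : probability T R) (f : T -> R) (c : R) :
  0 < c -> bounded_measurable f -> (forall s t, f s - f t <= c) ->
  \int[P]_t expR (f t) <= expR (\int[P]_t f t + c ^+ 2 / 8).
Proof.
move=> c0 bf fc.
have [t0 _] := le_mean_witness P ltr01 bf.
have [M fM] := bf.2.
have infr : has_inf (range f).
  split; first by exists (f t0), t0.
  by exists (- M) => _ [t _ <-]; have := fM t; rewrite ler_norml => /andP[].
pose a := inf (range f).
have fa t : a <= f t by apply: ge_inf; [exact: infr.2|exists t].
have fac t : f t <= a + c.
  rewrite -lerBlDr; apply: lb_le_inf; first exact: infr.1.
  by move=> _ [s _ <-]; rewrite lerBlDr addrC -lerBlDr.
pose m := \int[P]_t f t.
have ma : a <= m.
  by rewrite -(mean_cst P a); apply: le_mean => //; exact: bm_cst.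
have mac : m <= a + c.
  by rewrite -(mean_cst P (a + c)); apply: le_mean => //; exact: bm_cst.
pose q t := c^-1 * (f t - a).
have bq : bounded_measurable q by apply/bmZ/bmB => //; exact: bm_cst.
have qE : \int[P]_t q t = c^-1 * (m - a).
  rewrite meanZ; last by apply: bmB => //; exact: bm_cst.
  by rewrite meanB ?mean_cst //; exact: bm_cst.
have q01 x : a <= x -> x <= a + c -> 0 <= c^-1 * (x - a) <= 1.
  move=> ax xac; apply/andP; split.
    by rewrite mulr_ge0 ?invr_ge0 ?subr_ge0 // ltW.
  by rewrite (mulrC c^-1) ler_pdivrMr // mul1r lerBlDl.
have le1 : \int[P]_t expR (f t) <=
    expR a * (1 + (expR c - 1) * (c^-1 * (m - a))).
  rewrite -qE -meanZ // -[X in X + _](mean_cst P) -meanD; last 2 first.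
  - exact: bm_cst.
  - exact: bmZ.
  rewrite -meanZ; last by apply: bmD; [exact: bm_cst|exact: bmZ].
  apply: le_mean; first exact: bm_expR.
    by apply/bmZ/bmD; [exact: bm_cst|exact: bmZ].
  have qt01 t : 0 <= q t <= 1 by exact: q01.
  move=> t; have -> : f t = a + q t * c by rewrite /q; field; rewrite gt_eqF.
  rewrite expRD ler_wpM2l ?expR_ge0 // (le_trans (expR_chord _ (qt01 t))) //.
  by rewrite le_eqVlt; apply/orP; left; apply/eqP; ring.
apply: (le_trans le1).
have := bernoulli_mgf_le (q01 _ ma mac) (ltW c0).
set p := c^-1 * (m - a) => b.
have -> : m + c ^+ 2 / 8 = a + (p * c + c ^+ 2 / 8).
  by rewrite /p; field; rewrite gt_eqF.
rewrite expRD ler_wpM2l ?expR_ge0 //; apply: le_trans b.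
by rewrite le_eqVlt; apply/orP; left; apply/eqP; ring.
Qed.

Lemma mean_distribution (R : realType) d d' (Om : measurableType d)
    (T : measurableType d') (P : probability Om R) (X : {mfun Om >-> T})
    (f : T -> R) :
  bounded_measurable f -> \int[distribution P X]_t f t = \int[P]_w f (X w).
Proof.
move=> bf; rewrite /Rintegral integral_distribution //.
  by apply/measurable_EFinP; exact: bf.1.
by apply: bm_integrableP; exact: (bm_comp bf).
Qed.

(** * Overwriting and resampling one coordinate of the sample *)

Section update.
Context (T : Type) (n : nat).
Implicit Types (t u : n.-tuple T) (i j : 'I_n).

Definition upd t j (s : T) : n.-tuple T :=
  [tuple if i == j then s else tnth t i | i < n].

Lemma tnth_upd t j s i : tnth (upd t j s) i = if i == j then s else tnth t i.
Proof. by rewrite tnth_mktuple. Qed.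

Lemma updK t j s s' : upd (upd t j s) j s' = upd t j s'.
Proof. by apply: eq_from_tnth => i; rewrite !tnth_upd; case: eqP. Qed.

Lemma updC t i j s s' : i != j -> upd (upd t i s) j s' = upd (upd t j s') i s.
Proof.
move=> ij; apply: eq_from_tnth => l; rewrite !tnth_upd.
by have [->|//] := eqVneq l j; rewrite eq_sym (negbTE ij).
Qed.

(** Overwrite the coordinates of [t] by those of [u] one after the other. *)
Lemma upd_invariant_cst (U : Type) (f : n.-tuple T -> U) :
  (forall i t s, f (upd t i s) = f t) -> forall t u, f t = f u.
Proof.
move=> fI t u; pose step t' i := upd t' i (tnth u i).
have fstep r t' : f (foldl step t' r) = f t'.
  by elim: r t' => //= i r IH t'; rewrite IH fI.
rewrite -(fstep (enum 'I_n)); congr f; apply: eq_from_tnth => i.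
suff tnth_step r t' :
    tnth (foldl step t' r) i = if i \in r then tnth u i else tnth t' i.
  by rewrite tnth_step mem_enum.
elim: r t' => //= j r IH t'; rewrite IH in_cons tnth_upd.
by have [->|] := eqVneq i j; rewrite /= ?if_same.
Qed.

End update.

Lemma measurable_upd d (T : measurableType d) n (j : 'I_n) :
  measurable_fun setT (fun z : n.-tuple T * T => upd z.1 j z.2).
Proof.
apply/measurable_fun_tnthP => i.
rewrite [X in measurable_fun _ X](_ : _ =
    fun z => if i == j then z.2 else tnth z.1 i); last first.
  by apply/funext => z /=; rewrite tnth_upd.
case: eqP => _; first exact: measurable_snd.
exact: measurableT_comp (measurable_tnth i) measurable_fst.
Qed.

Lemma tuple_measure_unique (R : realType) d (T : measurableType d) n
    (m1 m2 : {measure set (n.-tuple T) -> \bar R}) : (m1 setT < +oo)%E ->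
  (forall A : 'I_n -> set T, (forall i, measurable (A i)) ->
    m1 [set t | forall i, A i (tnth t i)] =
    m2 [set t | forall i, A i (tnth t i)]) ->
  forall B, measurable B -> m1 B = m2 B.
Proof.
move=> m1T m12.
pose box (A : 'I_n -> set T) := [set t : n.-tuple T | forall i, A i (tnth t i)].
pose G := [set B | exists2 A : 'I_n -> set T, forall i, measurable (A i) & box A = B].
have GT : G setT.
  by exists (fun=> setT) => //; apply/seteqP; split.
have boxE A : box A = \bigcap_(i in [set: 'I_n]) ((fun t => tnth t i) @^-1` A i).
  by apply/seteqP; split=> t /= At i; [move=> _|]; exact: At.
have Gm : G `<=` measurable.
  move=> _ [A mA <-]; rewrite boxE; apply: fin_bigcap_measurable => // i _.
  by rewrite -[X in measurable X]setTI; exact: measurable_tnth.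
move=> B mB; apply: (g_sigma_algebra_measure_unique G Gm (fun=> setT)) => //.
- by apply/seteqP; split=> // z _; exists 0%N.
- move=> _ _ [A1 mA1 <-] [A2 mA2 <-].
  exists (fun i => A1 i `&` A2 i); first by move=> i; exact: measurableI.
  by apply/seteqP; split=> t /=; [move=> At; split=> i; have [] := At i
    |move=> [At1 At2] i; split].
- by move=> _ [A mA <-]; exact: m12.
- move: mB; apply: smallest_sub; first exact: smallest_sigma_algebra.
  rewrite -bigcup_seq => _ [i _ [A mA <-]]; apply: sub_sigma_algebra.
  exists (fun j => if j == i then A else setT); first by move=> j; case: ifP.
  apply/seteqP; split=> t /=.
    by move=> /(_ i); rewrite eqxx.
  by move=> [_ At] j; case: eqP => // ->.
Qed.

Section resampling.
Context (R : realType) d (T : measurableType d) (P : probability T R).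
Context d' (Om : measurableType d') (Pr : probability Om R).
Variables (n : nat) (Z : 'I_n -> {mfun Om >-> T}).
Hypothesis Z_iid : iid Pr P Z.

Definition sample (w : Om) : n.-tuple T := [tuple Z i w | i < n].

Lemma measurable_sample : measurable_fun setT sample.
Proof.
apply/measurable_fun_tnthP => i.
rewrite (_ : _ \o _ = Z i); first exact: measurable_funPT.
by apply/funext => w; rewrite /= tnth_mktuple.
Qed.

HB.instance Definition _ :=
  isMeasurableFun.Build _ _ _ _ sample measurable_sample.

Let resampled (j : 'I_n) (z : Om * T) : n.-tuple T := upd (sample z.1) j z.2.

Let measurable_resampled j : measurable_fun setT (resampled j).
Proof.
have mp : measurable_fun setT (fun z : Om * T => (sample z.1, z.2)).
  apply: measurable_fun_pair; last exact: measurable_snd.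
  exact: measurableT_comp measurable_sample measurable_fst.
exact: measurableT_comp (measurable_upd (T := T) j) mp.
Qed.

HB.instance Definition _ j :=
  isMeasurableFun.Build _ _ _ _ (resampled j) (measurable_resampled j).

Let iid_inter (J : {set 'I_n}) (A : 'I_n -> set T) :
  (forall i, measurable (A i)) ->
  Pr [set w | forall i, i \in J -> A i (Z i w)] = (\prod_(i in J) P (A i))%E.
Proof.
move=> mA; rewrite (_ : [set w | _] = \bigcap_(i in [set` J]) (Z i @^-1` A i)) //.
by rewrite Z_iid.2 //; apply: eq_bigr => i _; exact: Z_iid.1.
Qed.

(** The form in which independence enters what follows: a fresh draw from [P] in place of coordinate
    [j] leaves the law of the sample unchanged. Both laws give the same product on boxes, so no
    product measure on tuples has to be built. *)
Lemma mean_resample (f : n.-tuple T -> R) (j : 'I_n) : bounded_measurable f ->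
  \int[Pr]_w f (sample w) = \int[Pr]_w \int[P]_s f (upd (sample w) j s).
Proof.
move=> bf; have := mean_distribution Pr sample bf; rewrite /= => <-.
have bfr : bounded_measurable (fun z => f (resampled j z)).
  exact: (bm_comp bf (measurable_resampled j)).
rewrite -(mean_prod bfr).
have := mean_distribution (Pr \x P)%E (resampled j) bf; rewrite /= => <-.
congr fine; apply: eq_measure_integral => B mB _.
apply: tuple_measure_unique mB; first exact: probability_lty.
move=> A mA.
have E1 : sample @^-1` [set t | forall i, A i (tnth t i)] =
    [set w | forall i, i \in [set: 'I_n]%SET -> A i (Z i w)].
  apply/seteqP; split => w /= Aw i; move: (Aw i); rewrite tnth_mktuple //.
  by apply; rewrite inE.
have E2 : resampled j @^-1` [set t | forall i, A i (tnth t i)] =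
    [set w | forall i, i \in [set~ j]%SET -> A i (Z i w)] `*` A j.
  apply/seteqP; split => [[w s] /= Aws|[w s] /= [Aw As] i].
    split=> [i|]; last by have := Aws j; rewrite tnth_upd eqxx.
    rewrite !inE => ij; have := Aws i.
    by rewrite tnth_upd (negbTE ij) tnth_mktuple.
  rewrite tnth_upd; have [->//|ij] := eqVneq i j.
  by rewrite tnth_mktuple; apply: Aw; rewrite !inE.
rewrite [LHS](congr1 Pr E1) [RHS](congr1 (Pr \x P)%E E2) iid_inter //.
rewrite product_measure1E //; last first.
  rewrite (_ : [set w | _] = \bigcap_(i in [set` [set~ j]%SET]) (Z i @^-1` A i)) //.
  apply: fin_bigcap_measurable => // i _.
  by rewrite -[X in measurable X]setTI; exact: measurable_funPT.
rewrite [X in (_ = X * _)%E]iid_inter // (bigD1 j) ?inE //= muleC.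
by congr (_ * _)%E; apply: eq_bigl => i; rewrite !inE.
Qed.

End resampling.

Lemma measurable_superlevel (R : realType) d (T : measurableType d)
    (f : T -> R) (a : R) :
  measurable_fun setT f -> measurable [set t | a <= f t].
Proof.
move=> mf; rewrite -[X in measurable X]setTI -preimage_itvcy.
by apply: mf => //; exact: measurable_itv.
Qed.

(** * McDiarmid's inequality *)

Section mcdiarmid.
Context (R : realType) d (T : measurableType d) (P : probability T R).
Context d' (Om : measurableType d') (Pr : probability Om R).
Variables (n : nat) (Z : 'I_n -> {mfun Om >-> T}).
Hypothesis Z_iid : iid Pr P Z.
Implicit Types (f : n.-tuple T -> R) (i j : 'I_n).

Local Notation X := (sample Z).

(** Acts as the conditional expectation of [f] given the coordinates other than [j]. *)
Definition average_coord f j t := \int[P]_s f (upd t j s).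

Lemma bm_average_coord f j :
  bounded_measurable f -> bounded_measurable (average_coord f j).
Proof.
move=> bf; apply: (bm_mean (f := fun z => f (upd z.1 j z.2))).
exact: (bm_comp bf (measurable_upd j)).
Qed.

Lemma bm_sample f : bounded_measurable f -> bounded_measurable (fun w => f (X w)).
Proof. by move=> bf; apply: (bm_comp bf); exact: measurable_sample. Qed.

Let bm_upd f t j : bounded_measurable f -> bounded_measurable (fun s => f (upd t j s)).
Proof.
move=> bf; apply: (bm_pair1 (f := fun z => f (upd z.1 j z.2))).
exact: (bm_comp bf (measurable_upd j)).
Qed.

Let osc (c : R) f := forall i t s s', f (upd t i s) - f (upd t i s') <= c.

Let osc_average c f j : 0 <= c -> bounded_measurable f -> osc c f ->
  osc c (average_coord f j).
Proof.
move=> c0 bf fc i t s s'; rewrite /average_coord.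
have [->|ij] := eqVneq i j.
  under eq_Rintegral do rewrite updK.
  by under [X in _ - X]eq_Rintegral do rewrite updK; rewrite subrr.
rewrite -meanB; try exact: bm_upd.
rewrite -(mean_cst P c); apply: le_mean; last by move=> u; rewrite !(updC _ _ _ ij).
  by apply: bmB; exact: bm_upd.
exact: bm_cst.
Qed.

Let average_inv_self f j t s : average_coord f j (upd t j s) = average_coord f j t.
Proof. by apply: eq_Rintegral => u _; rewrite updK. Qed.

Let average_inv f j i : (forall t s, f (upd t i s) = f t) ->
  forall t s, average_coord f j (upd t i s) = average_coord f j t.
Proof.
move=> fi t s; have [->|ij] := eqVneq i j; first exact: average_inv_self.
by apply: eq_Rintegral => u _; rewrite updC // fi.
Qed.

(** Average out the coordinates one by one. Each averaging keeps the mean and the oscillation bound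
    and, by Hoeffding's lemma applied to the resampled coordinate, costs a factor
    [expR (c ^+ 2 / 8)]. After all [n] coordinates the function is constant, hence equal to its
    mean. *)
Lemma mcdiarmid_mgf f (c : R) : 0 < c -> bounded_measurable f ->
  (forall i t s s', f (upd t i s) - f (upd t i s') <= c) ->
  \int[Pr]_w expR (f (X w)) <=
  expR (\int[Pr]_w f (X w) + n%:R * (c ^+ 2 / 8)).
Proof.
move=> c0 bf fc.
have step g j : bounded_measurable g -> osc c g ->
    \int[Pr]_w expR (g (X w)) <=
    expR (c ^+ 2 / 8) * \int[Pr]_w expR (average_coord g j (X w)).
  move=> bg gc; rewrite (mean_resample Z_iid j (bm_expR bg)) -meanZ; last first.
    exact: (bm_sample (bm_expR (bm_average_coord j bg))).
  apply: le_mean.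
  - exact: (bm_sample (bm_average_coord j (bm_expR bg))).
  - exact: (bm_sample (bmZ _ (bm_expR (bm_average_coord j bg)))).
  - move=> w; rewrite mulrC -expRD; apply: hoeffding_lemma => //.
    exact: bm_upd.
pose F r := foldl average_coord f r.
have Fr r : [/\ bounded_measurable (F r), osc c (F r),
    forall i, i \in r -> forall t s, F r (upd t i s) = F r t,
    \int[Pr]_w F r (X w) = \int[Pr]_w f (X w) &
    \int[Pr]_w expR (f (X w)) <=
      expR ((size r)%:R * (c ^+ 2 / 8)) * \int[Pr]_w expR (F r (X w))].
  elim/last_ind: r => [|r j [bF oF iF mF eF]].
    by split=> //; rewrite mul0r expR0 mul1r.
  rewrite /F foldl_rcons -/(F r); split.
  - exact: bm_average_coord.
  - by apply: osc_average => //; exact: ltW.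
  - move=> i; rewrite mem_rcons in_cons => /predU1P[->|ir] t s.
      exact: average_inv_self.
    by apply: average_inv; exact: iF.
  - by rewrite -mF (mean_resample Z_iid j bF).
  - rewrite (le_trans eF) // size_rcons -[(size r).+1%:R]natr1.
    rewrite mulrDl mul1r expRD -mulrA.
    by rewrite ler_wpM2l ?expR_ge0 //; exact: step.
have [bF _ iF mF eF] := Fr (enum 'I_n).
have Fcst : forall t u, F (enum 'I_n) t = F (enum 'I_n) u.
  by apply: upd_invariant_cst => i; apply: iF; rewrite mem_enum.
(* Used only to produce a point of [Om], at which the constant is evaluated. *)
have [w0 _] := le_mean_witness Pr ltr01 (bm_sample bf).
rewrite (le_trans eF) // size_enum_ord addrC expRD ler_wpM2l ?expR_ge0 //.
have FE w : F (enum 'I_n) (X w) = F (enum 'I_n) (X w0) by exact: Fcst.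
rewrite -mF; under eq_Rintegral do rewrite FE.
by under [in leRHS]eq_Rintegral do rewrite FE; rewrite !mean_cst.
Qed.

Lemma mcdiarmid f (c x : R) : (0 < n)%N -> 0 < c -> 0 <= x ->
  bounded_measurable f ->
  (forall i t s s', f (upd t i s) - f (upd t i s') <= c) ->
  (Pr [set w | (\int[Pr]_w f (X w) + x <= f (X w))%R] <=
    (expR (- (2 * x ^+ 2 / (n%:R * c ^+ 2))))%:E)%E.
Proof.
move=> n0 c0 x0 bf fc; set m := \int[Pr]_w f (X w).
(* For [x = 0] the bound is 1; this case is set apart because the Chernoff parameter [l] must be
   positive. *)
have [->|x_neq0] := eqVneq x 0.
  rewrite expr0n /= mulr0 mul0r oppr0 expR0; apply: probability_le1.
  exact: measurable_superlevel (bm_sample bf).1.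
have x_gt0 : 0 < x by rewrite lt_neqAle eq_sym x_neq0.
have nR : 0 < n%:R :> R by rewrite ltr0n.
(* Minimizer of the Chernoff exponent [- l * x + n * (l * c) ^ 2 / 8]. *)
pose l := 4 * x / (n%:R * c ^+ 2).
have l0 : 0 < l by rewrite divr_gt0 ?mulr_gt0 ?exprn_gt0.
set A := [set w | _].
have mA : measurable A.
  exact: measurable_superlevel (bm_sample bf).1.
pose g t := l * f t - l * (m + x).
have bg : bounded_measurable g by apply: bmB; [exact: bmZ|exact: bm_cst].
have : \int[Pr]_w \1_A w <= \int[Pr]_w expR (g (X w)).
  apply: le_mean.
  - split; first exact: measurable_indic.
    by exists 1 => w; rewrite ger0_norm ?indicE //; case: (_ \in _).
  - exact: (bm_sample (bm_expR bg)).
  - move=> w; rewrite indicE; case: (boolP (w \in A)) => [|_]; last exact: expR_ge0.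
    rewrite inE /A /= => Aw; rewrite -expR0 ler_expR /g -mulrBr.
    by rewrite mulr_ge0 ?subr_ge0 // ltW.
have le_g : \int[Pr]_w expR (g (X w)) <=
    expR (\int[Pr]_w g (X w) + n%:R * ((l * c) ^+ 2 / 8)).
  apply: mcdiarmid_mgf => //; first exact: mulr_gt0.
  move=> i t s s'; rewrite /g; set a := f (upd t i s); set b := f (upd t i s').
  have -> : l * a - l * (m + x) - (l * b - l * (m + x)) = l * (a - b) by ring.
  by apply: ler_wpM2l; [exact: ltW|exact: fc].
move=> /le_trans/(_ le_g).
have -> : \int[Pr]_w g (X w) = - (l * x).
  have bX := bm_sample bf.
  rewrite /g meanB; [|exact: bmZ|exact: bm_cst].
  by rewrite mean_cst meanZ // -/m; ring.
have -> : - (l * x) + n%:R * ((l * c) ^+ 2 / 8) = - (2 * x ^+ 2 / (n%:R * c ^+ 2)).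
  by rewrite /l; field; rewrite !gt_eqF.
rewrite -lee_fin /Rintegral fineK; last first.
  apply: integrable_fin_num => //; apply: bm_integrableP; split.
    exact: measurable_indic.
  by exists 1 => w; rewrite ger0_norm ?indicE //; case: (_ \in _).
by rewrite integral_indic // setIT.
Qed.

End mcdiarmid.

(** * Deviation of the empirical measure *)

Section deviation_vector.
Context (R : realType) d (T : measurableType d) (P : probability T R).
Variables (k : T -> T -> R) (n : nat).
Local Notation K := (kext P k).

(* [P] minus the empirical measure of [z]. *)
Definition devector (z : 'I_n -> T) : seq (R * option T) :=
  (1, None) :: [seq (- n%:R^-1, Some (z i)) | i <- index_enum 'I_n].

Definition deviation (z : 'I_n -> T) : R :=
  Num.sqrt (bform K (devector z) (devector z)).

Lemma bform_devectorl z l : bform K (devector z) l =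
  bform K [:: (1, None)] l - n%:R^-1 * \sum_i bform K [:: (1, Some (z i))] l.
Proof.
rewrite bform_consl; congr (_ + _); rewrite /bform big_map mulr_sumr -sumrN.
apply: eq_bigr => i _; rewrite big_seq1 mulr_sumr -sumrN.
by apply: eq_bigr => q _ /=; ring.
Qed.

Lemma bform_scale1 (c : R) x l :
  bform K [:: (c, x)] l = c * bform K [:: (1, x)] l.
Proof. by rewrite -[c in LHS]mulr1 -bform_scalel. Qed.

Hypothesis pdk : pd_kernel k.

Lemma bform_devector z : bform K (devector z) (devector z) =
  K None None - 2 * n%:R^-1 * \sum_i K None (Some (z i)) +
  n%:R^-1 ^+ 2 * \sum_i \sum_j k (z i) (z j).
Proof.
have KC := kextC P pdk.
rewrite bform_devectorl (bformC _ _ KC) bform_devectorl !bform1 !mul1r.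
under eq_bigr do rewrite bform1 !mul1r.
under [X in _ - _ * X]eq_bigr => i _.
  rewrite (bformC _ _ KC) bform_devectorl bform1 !mul1r.
  under eq_bigr do rewrite bform1 !mul1r [K _ _]/= (pdk.1 _ (z i)).
  over.
rewrite sumrB -mulr_sumr.
under eq_bigr do rewrite KC.
by ring.
Qed.

End deviation_vector.
Arguments devector {R d T n} z.

Section concentration.
Context (R : realType) d (T : measurableType d) (P : probability T R).
Variable k : T -> T -> R.
Hypothesis pdk : pd_kernel k.
Hypothesis mk : measurable_fun setT (fun z : T * T => k z.1 z.2).
Hypothesis k1 : forall s t, `|k s t| <= 1.
Local Notation K := (kext P k).

Let bk : bounded_measurable (fun z : T * T => k z.1 z.2).
Proof. by split => //; exists 1 => z; exact: k1. Qed.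

Let pdK : pd_kernel K := pd_kext P pdk mk k1.
Let bK x : bounded_measurable (fun t => K x (Some t)) := bm_kext P mk k1 x.

Variable n : nat.
Hypothesis n_gt0 : (0 < n)%N.
Let nR : 0 < n%:R :> R. Proof. by rewrite ltr0n. Qed.

(** As linear forms, though not as lists, the two deviation vectors differ by [m], a difference of
    two point masses of weight 1/n. The triangle inequality leaves the seminorm of [m], whose square
    is [(k s s + k s' s' - 2 * k s s') / n ^ 2]. *)
Lemma deviation_osc (t : n.-tuple T) i s s' :
  deviation P k (tnth (upd t i s)) - deviation P k (tnth (upd t i s')) <= 2 / n%:R.
Proof.
rewrite /deviation lerBlDl; set u := tnth (upd t i s); set u' := tnth (upd t i s').
pose m := [:: (n%:R^-1 : R, Some s'); (- n%:R^-1, Some s)].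
have lin l : bform K (devector u) l = bform K (devector u' ++ m) l.
  rewrite bform_catl (bform_consl _ (n%:R^-1, _)) (bform_scale1 P k n%:R^-1).
  rewrite (bform_scale1 P k (- n%:R^-1)) !bform_devectorl.
  rewrite (bigD1 i) //= [in RHS](bigD1 i) //= /u /u' !tnth_upd eqxx.
  set a := \sum_(_ | _) _; set b := \sum_(_ | _) _.
  have -> : a = b.
    by apply: eq_bigr => j ji; rewrite !tnth_upd (negbTE ji).
  by ring.
rewrite lin (bformC _ _ pdK.1) lin (le_trans (sqrt_bformD _ _ pdK)) // lerD2l.
have -> : 2 / n%:R = Num.sqrt ((2 / n%:R) ^+ 2) :> R.
  by rewrite sqrtr_sqr ger0_norm // divr_ge0 // ltW.
apply: ler_wsqrtr; rewrite /m bform_consl !(bform_consr _ _ _ [:: _]) !bform1 /=.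
have := k1 s s; have := k1 s' s'; have := k1 s s'; rewrite (pdk.1 s' s) !ler_norml.
move=> /andP[a1 _] /andP[_ a2] /andP[_ a3].
have -> : n%:R^-1 * n%:R^-1 * k s' s' + n%:R^-1 * - n%:R^-1 * k s s' +
    (- n%:R^-1 * n%:R^-1 * k s s' + - n%:R^-1 * - n%:R^-1 * k s s) =
    n%:R^-1 ^+ 2 * (k s s + k s' s' - 2 * k s s') by ring.
rewrite exprMn mulrC ler_wpM2r ?sqr_ge0 //; lra.
Qed.

Lemma bm_deviation :
  bounded_measurable (fun t : n.-tuple T => deviation P k (tnth t)).
Proof.
apply: bm_sqrt; under eq_fun do rewrite bform_devector //.
have bi i : bounded_measurable (fun t : n.-tuple T => K None (Some (tnth t i))).
  exact: (bm_comp (bK None) (measurable_tnth i)).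
have bij i j : bounded_measurable (fun t : n.-tuple T => k (tnth t i) (tnth t j)).
  apply: (bm_comp bk (h := fun t : n.-tuple T => (tnth t i, tnth t j))).
  by apply: measurable_fun_pair; exact: measurable_tnth.
apply: bmD; first by apply: bmB; [exact: bm_cst|exact/bmZ/bm_sum].
by apply/bmZ/bm_sum => i; exact: bm_sum.
Qed.

Context d' (Om : measurableType d') (Pr : probability Om R).
Variable Z : 'I_n -> {mfun Om >-> T}.
Hypothesis Z_iid : iid Pr P Z.

Local Notation dev w := (deviation P k (fun i => Z i w)).

Let devE w : deviation P k (tnth (sample Z w)) = dev w.
Proof.
by congr (deviation _ _ _); apply/funext => i; rewrite tnth_mktuple.
Qed.

Lemma bm_deviation_sample : bounded_measurable (fun w => dev w).
Proof. by under eq_fun do rewrite -devE; exact: (bm_sample Z bm_deviation). Qed.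

Let mean_marginal i g : bounded_measurable g ->
  \int[Pr]_w g (Z i w) = \int[P]_t g t.
Proof.
move=> bg; rewrite -(mean_distribution Pr (Z i) bg); congr fine.
by apply: eq_measure_integral => A mA _; exact: Z_iid.1.
Qed.

Let mean_pair i j : i != j -> \int[Pr]_w k (Z i w) (Z j w) = K None None.
Proof.
move=> ij; pose f (t : n.-tuple T) := k (tnth t i) (tnth t j).
have bf : bounded_measurable f.
  apply: (bm_comp bk (h := fun t : n.-tuple T => (tnth t i, tnth t j))).
  by apply: measurable_fun_pair; exact: measurable_tnth.
transitivity (\int[Pr]_w f (sample Z w)).
  by apply: eq_Rintegral => w _; rewrite /f !tnth_mktuple.
rewrite (mean_resample Z_iid j bf) -(mean_kext P k None) -(mean_marginal i (bK None)).
apply: eq_Rintegral => w _; rewrite kextC //=; apply: eq_Rintegral => s _.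
by rewrite /f !tnth_upd eqxx (negbTE ij) tnth_mktuple.
Qed.

(** Pairs of distinct indices contribute only [K None None], so the mean square is the variance term
    [(\int k t t - K None None) / n], at most 1/n. The inequality [v <= (r * v ^ 2 + 1 / r) / 2]
    then replaces Jensen's for the square root; [r = sqrt n] balances its two terms. *)
Lemma mean_deviation_le : \int[Pr]_w dev w <= (Num.sqrt n%:R)^-1.
Proof.
set r := Num.sqrt n%:R; have r0 : 0 < r by rewrite sqrtr_gt0.
have rr : r ^+ 2 = n%:R by rewrite sqr_sqrtr // ltW.
have bij i j : bounded_measurable (fun w => k (Z i w) (Z j w)).
  apply: (bm_comp bk (h := fun w => (Z i w, Z j w))).
  by apply: measurable_fun_pair; exact: measurable_funPT.
have bi i : bounded_measurable (fun w => K None (Some (Z i w))).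
  by apply: (bm_comp (bK None)); exact: measurable_funPT.
pose q w := bform K (devector (fun i => Z i w)) (devector (fun i => Z i w)).
have q0 w : 0 <= q w by exact: bform_ge0.
have qE w : q w = K None None - 2 * n%:R^-1 * \sum_i K None (Some (Z i w)) +
    n%:R^-1 ^+ 2 * \sum_i \sum_j k (Z i w) (Z j w) by exact: bform_devector.
have bs1 : bounded_measurable (fun w => \sum_i K None (Some (Z i w))).
  exact: bm_sum.
have bs2 : bounded_measurable (fun w => \sum_i \sum_j k (Z i w) (Z j w)).
  by apply: bm_sum => i; exact: bm_sum.
have bq : bounded_measurable q.
  rewrite (funext qE); apply: bmD; last exact: bmZ.
  by apply: bmB; [exact: bm_cst|exact: bmZ].
have bd := bm_kext_diag mk k1.
have mq : \int[Pr]_w q w = n%:R^-1 * (\int[P]_t k t t - K None None).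
  rewrite (funext qE) meanD; [|by apply: bmB; [exact: bm_cst|exact: bmZ]|exact: bmZ].
  rewrite meanB; [|exact: bm_cst|exact: bmZ].
  rewrite mean_cst !meanZ // !mean_sum //; last by move=> i; exact: bm_sum.
  under eq_bigr do rewrite (mean_marginal _ (bK None)) mean_kext.
  rewrite sumr_const card_ord.
  have -> : \sum_(i < n) \int[Pr]_w (\sum_(j < n) k (Z i w) (Z j w)) =
      \sum_(i < n) (\int[P]_t k t t - K None None + K None None *+ n).
    apply: eq_bigr => i _; rewrite mean_sum // (bigD1 i) //=.
    rewrite (mean_marginal i bd) -addrA; congr (_ + _).
    rewrite (eq_bigr (fun=> K None None)); last first.
      by move=> j; rewrite eq_sym; exact: mean_pair.
    rewrite sumr_const cardC1 card_ord.
    by rewrite -{2}(prednK n_gt0) mulrS addKr.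
  rewrite sumr_const card_ord -(mulr_natl (K None None) n) -(mulr_natl (_ + _) n).
  by field; rewrite gt_eqF.
have mq1 : \int[Pr]_w q w <= n%:R^-1.
  rewrite mq ler_piMr ?invr_ge0 ?ler0n // lerBlDr.
  have := normr_mean_le P bd (fun t => k1 t t); rewrite ler_norml => /andP[_].
  have := bform_ge0 [:: (1, None)] pdK; rewrite bform1 !mul1r /=; lra.
have AMGM w : dev w <= 2^-1 * (r * q w + r^-1).
  rewrite /deviation -/(q w).
  have h := sqr_ge0 (r * Num.sqrt (q w) - 1).
  rewrite -(ler_pM2l r0) -[in leRHS](sqr_sqrtr (q0 w)).
  set v := Num.sqrt (q w) in h *.
  have -> : r * (2^-1 * (r * v ^+ 2 + r^-1)) =
      2^-1 * (r * v - 1) ^+ 2 + r * v by field; rewrite gt_eqF.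
  by rewrite lerDr mulr_ge0.
apply: (le_trans (le_mean Pr bm_deviation_sample _ AMGM)).
  by apply/bmZ/bmD; [exact: bmZ|exact: bm_cst].
rewrite meanZ; last by apply/bmD; [exact: bmZ|exact: bm_cst].
rewrite meanD ?mean_cst; [|exact: bmZ|exact: bm_cst]; rewrite meanZ //.
have : r * \int[Pr]_w q w <= r^-1.
  rewrite (le_trans (ler_wpM2l (ltW r0) mq1)) // -rr.
  by rewrite le_eqVlt; apply/orP; left; apply/eqP; field; rewrite gt_eqF.
lra.
Qed.

Lemma deviation_tail (x : R) : 0 <= x ->
  (Pr [set w | ((Num.sqrt n%:R)^-1 * (1 + Num.sqrt (2 * x)) <= dev w)%R] <=
    (expR (- x))%:E)%E.
Proof.
move=> x0; set r := Num.sqrt n%:R; have r0 : 0 < r by rewrite sqrtr_gt0.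
have rr : r ^+ 2 = n%:R by rewrite sqr_sqrtr // ltW.
(* With differences bounded by 2/n, McDiarmid's exponent at [y] is [n * y ^ 2 / 2], which equals
   [x]. *)
pose y := r^-1 * Num.sqrt (2 * x).
have y0 : 0 <= y by rewrite mulr_ge0 ?sqrtr_ge0 // invr_ge0 ltW.
have c0 : 0 < 2 / n%:R :> R by rewrite divr_gt0.
have := mcdiarmid Z_iid n_gt0 c0 y0 bm_deviation.
move=> /(_ (fun i t => deviation_osc t i)).
have -> : 2 * y ^+ 2 / (n%:R * (2 / n%:R) ^+ 2) = x.
  rewrite /y exprMn sqr_sqrtr ?mulr_ge0 // -rr.
  by field; rewrite gt_eqF.
apply: le_trans; apply: le_measure.
- by rewrite inE; exact: measurable_superlevel bm_deviation_sample.1.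
- rewrite inE; exact: measurable_superlevel (bm_sample Z bm_deviation).1.
- move=> w /=; rewrite devE; apply: le_trans.
  under eq_Rintegral do rewrite devE.
  by rewrite mulrDr mulr1 lerD2r; exact: mean_deviation_le.
Qed.

End concentration.

(** * Means in Hilbert spaces *)

Section hilbert_theory.
Context (R : realType) (H : hilbert R).
Implicit Types f g h : H.

Lemma dotpDr f g h : dotp h (f + g) = dotp h f + dotp h g.
Proof. by rewrite !(dotpC h) dotpDl. Qed.

Lemma dotpZr a f h : dotp h (a *: f) = a * dotp h f.
Proof. by rewrite !(dotpC h) dotpZl. Qed.

Lemma dotpNl f h : dotp (- f) h = - dotp f h.
Proof. by rewrite -scaleN1r dotpZl mulN1r. Qed.

Lemma dotpBl f g h : dotp (f - g) h = dotp f h - dotp g h.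
Proof. by rewrite dotpDl dotpNl. Qed.

Lemma dotpBr f g h : dotp h (f - g) = dotp h f - dotp h g.
Proof. by rewrite !(dotpC h) dotpBl. Qed.

Lemma dotp0l h : dotp 0 h = 0.
Proof. by rewrite -(scale0r h) dotpZl mul0r. Qed.

Lemma dotp_suml (I : Type) (r : seq I) (F : I -> H) h :
  dotp (\sum_(i <- r) F i) h = \sum_(i <- r) dotp (F i) h.
Proof.
elim: r => [|i r IH]; first by rewrite !big_nil dotp0l.
by rewrite !big_cons dotpDl IH.
Qed.

Lemma dotp_sumr (I : Type) (r : seq I) (F : I -> H) h :
  dotp h (\sum_(i <- r) F i) = \sum_(i <- r) dotp h (F i).
Proof. by rewrite dotpC dotp_suml; apply: eq_bigr => i _; rewrite dotpC. Qed.

Lemma pd_kernel_dotp : pd_kernel (fun f g : H => dotp f g).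
Proof.
apply: pd_kernelP => [f g|l]; first exact: dotpC.
suff -> : bform (fun f g : H => dotp f g) l l =
    `|\sum_(p <- l) p.1 *: p.2| ^+ 2 by exact: sqr_ge0.
rewrite -dotp_norm dotp_suml; apply: eq_bigr => p _.
by rewrite dotp_sumr; apply: eq_bigr => q _; rewrite dotpZl dotpZr; ring.
Qed.

Lemma dotp_CS f g : `|dotp f g| <= `|f| * `|g|.
Proof.
rewrite -ler_sqr ?nnegrE ?mulr_ge0 // real_normK ?num_real // exprMn.
by rewrite -!dotp_norm; exact: (pd_kernel_CS f g pd_kernel_dotp).
Qed.

Lemma dotp_inj f g : (forall h, dotp h f = dotp h g) -> f = g.
Proof.
move=> fg; apply/eqP; rewrite -subr_eq0 -normr_eq0 -sqrf_eq0 -dotp_norm.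
by rewrite dotpBr fg subrr.
Qed.

Lemma cvg_dotpr (u : H^nat) l h :
  u @ \oo --> l -> dotp h (u n) @[n --> \oo] --> dotp h l.
Proof.
move=> /cvgrPdist_lt ul; apply/cvgrPdist_lt => e e0.
have h0 : 0 < `|h| + 1 by rewrite ltr_wpDl.
have [N _ NP] := ul _ (divr_gt0 e0 h0).
exists N => // n Nn; rewrite -dotpBr (le_lt_trans (dotp_CS _ _)) //.
have := NP n Nn; rewrite ltr_pdivlMr // => /(le_lt_trans _); apply.
by rewrite mulrC ler_wpM2l // lerDl.
Qed.

(* [m] minimizes [`|w| ^+ 2 - 2 * L w] over the closed subspace [W]. *)
Lemma riesz_subspace (W : set H) (L : H -> R) (c : R) :
  W 0 -> (forall a f g, W f -> W g -> W (a *: f + g)) ->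
  (forall (u : H^nat) l, (forall n, W (u n)) -> u @ \oo --> l -> W l) ->
  (forall a f g, L (a *: f + g) = a * L f + L g) ->
  (forall f, `|L f| <= c * `|f|) ->
  exists2 m, W m & forall w, W w -> dotp w m = L w.
Proof.
move=> W0 Wlin Wcl Llin Lc.
pose J h := dotp h h - 2 * L h.
have Jlb h : - c ^+ 2 <= J h.
  have := Lc h; rewrite ler_norml => /andP[_ Lh]; rewrite /J dotp_norm.
  have := sqr_ge0 (`|h| - c); rewrite sqrrB; lra.
have infJ : has_inf (J @` W).
  by split; [exists (J 0), 0|exists (- c ^+ 2) => _ [h _ <-]; exact: Jlb].
pose m0 := inf (J @` W).
have m0J h : W h -> m0 <= J h.
  by move=> Wh; apply: ge_inf; [exact: infJ.2|exists h].
have JZ a f g : J (a *: f + g) = a ^+ 2 * dotp f f + 2 * a * dotp f g + dotp g g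
    - 2 * (a * L f + L g).
  by rewrite /J Llin dotpDl !dotpDr !dotpZl !dotpZr (dotpC g f); ring.
have [u uP] : {u : H^nat & forall n, W (u n) /\ J (u n) < m0 + n.+1%:R^-1}.
  apply: (@choice _ _ (fun n h => W h /\ J h < m0 + n.+1%:R^-1)) => n.
  have [|_ [h Wh <-] hn] := @inf_adherent _ (J @` W) n.+1%:R^-1 _ infJ.
    by rewrite invr_gt0.
  by exists h.
(* Parallelogram identity: the mean of [J f] and [J g] exceeds [J] at the midpoint by a quarter of
   the squared distance, and the midpoint cannot go below [m0]. Minimizing sequences are therefore
   Cauchy. *)
have dist f g e : W f -> W g -> J f < m0 + e -> J g < m0 + e ->
    `|f - g| ^+ 2 <= 4 * e.
  move=> Wf Wg fe ge.
  have Wmid : W (2^-1 *: f + 2^-1 *: g).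
    by apply: (Wlin) => //; rewrite -[X in W X]addr0; exact: Wlin.
  have := m0J _ Wmid; rewrite JZ -[2^-1 *: g]addr0 Llin.
  rewrite addr0 dotpZr !dotpZl dotpZr.
  have L0 : L 0 = 0.
    by apply/eqP; rewrite -normr_le0 (le_trans (Lc 0)) // normr0 mulr0.
  rewrite L0 -dotp_norm dotpBl !dotpBr (dotpC g f).
  by move: fe ge; rewrite /J; lra.
have small (e : R) : 0 < e -> exists N, forall n, (N <= n)%N -> n.+1%:R^-1 < e.
  move=> e0; exists (Num.truncn e^-1) => n Nn.
  rewrite -[ltRHS]invrK ltf_pV2 ?posrE ?invr_gt0 // (lt_le_trans (truncnS_gt _)) //.
  by rewrite ler_nat.
have /cauchy_cvgP/cvg_ex[m um] : cauchy (u @ \oo).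
  apply: cauchy_exP => e e0.
  have e8 : 0 < e ^+ 2 / 8 by rewrite divr_gt0 ?exprn_gt0.
  have [N NP] := small _ e8.
  exists (u N); exists N => // n /= Nn; rewrite -ball_normE /=.
  have [WN JN] := uP N; have [Wn Jn] := uP n.
  have := dist (u N) (u n) (e ^+ 2 / 8) WN Wn.
  have := NP N (leqnn _); have := NP n Nn => n1 N1.
  move=> /(_ (lt_trans JN _) (lt_trans Jn _)); rewrite !ltrD2l => /(_ N1 n1) h.
  rewrite -(ltr_pXn2r (n := 2)) ?nnegrE // ?ltW // (le_lt_trans h) //.
  by have := exprn_gt0 2 e0; lra.
exists m; first by apply: Wcl um => n; have [] := uP n.
move=> w Ww; have um_w := @cvg_dotpr u m w um.
(* First variation at [m], obtained along the sequence: compare [J (t *: w + u N)] with [J (u N)],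
   then let [N] grow. The convergence of [dotp w (u N)] suffices, without continuity of [J]. *)
have var t : 0 <= 2 * t * (dotp w m - L w) + t ^+ 2 * dotp w w.
  apply/ler_addgt0Pr => e e0.
  have e2 : 0 < e / 2 by rewrite divr_gt0.
  have [N1 N1P] := small _ e2.
  have t1 : 0 < 2 * `|t| + 1 by rewrite ltr_wpDl // mulr_ge0.
  have /cvgrPdist_lt/(_ _ (divr_gt0 e2 t1)) [N2 _ N2P] := um_w.
  pose N := maxn N1 N2.
  have [WN JN] := uP N.
  have := m0J _ (Wlin t _ _ Ww WN); rewrite JZ => h1.
  have h2 := N1P N (leq_maxl _ _).
  have := N2P N (leq_maxr _ _); rewrite /= ltr_pdivlMr // => h3.
  have h4 : 2 * t * (dotp w (u N) - dotp w m) <= e / 2.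
    apply: le_trans (ltW h3); apply: (le_trans (ler_norm _)).
    rewrite !normrM (ger0_norm (ler0n _ 2)) distrC mulrC ler_wpM2l // lerDl //.
  by move: h1 h2 h4 JN; rewrite /J; set a := N.+1%:R^-1; lra.
have [w0|w0] := eqVneq (dotp w w) 0.
  have := var 1; have := var (-1); rewrite w0; lra.
have ww : 0 < dotp w w by rewrite lt_neqAle eq_sym w0 dotp_norm sqr_ge0.
apply/eqP; rewrite -subr_eq0 -sqrf_eq0 eq_le sqr_ge0 andbT.
set x := dotp w m - L w in var *.
have := var (- x / dotp w w).
have -> : 2 * (- x / dotp w w) * x + (- x / dotp w w) ^+ 2 * dotp w w =
    - (x ^+ 2 / dotp w w) by field.
by rewrite oppr_ge0 pmulr_lle0 // invr_gt0.
Qed.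

End hilbert_theory.

Section hilbert_means.
Context (R : realType) d (T : measurableType d) (H : hilbert R) (phi : T -> H).

Lemma hilbert_mean_unique (mu : {measure set T -> \bar R}) (m : H) :
  (forall h, mu.-integrable setT (EFin \o (fun t => dotp h (phi t))) /\
     dotp h m = \int[mu]_t dotp h (phi t)) ->
  hilbert_mean mu phi = m.
Proof.
move=> mP; apply: xget_unique => // m' m'P; apply: dotp_inj => h.
by rewrite (m'P h).2 (mP h).2.
Qed.

Hypothesis mphi : forall h, measurable_fun setT (fun t => dotp h (phi t)).
Hypothesis phi1 : forall t, `|phi t| <= 1.

Lemma bm_dotp h : bounded_measurable (fun t => dotp h (phi t)).
Proof.
split; first exact: mphi.
by exists `|h| => t; rewrite (le_trans (dotp_CS _ _)) // ler_piMr.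
Qed.

(** Existence of the weak integral: the functional sending [h] to the mean of [dotp h (phi t)] has
    norm at most 1, and Riesz representation on the whole space supplies the vector. *)
Lemma hilbert_meanE (P : probability T R) h :
  dotp h (hilbert_mean P phi) = \int[P]_t dotp h (phi t).
Proof.
have [|||a f g|f|m _ mP] := @riesz_subspace _ H setT
  (fun h => \int[P]_t dotp h (phi t)) 1 => //.
- rewrite -meanZ; last exact: bm_dotp.
  rewrite -meanD; [|exact/bmZ/bm_dotp|exact: bm_dotp].
  by apply: eq_Rintegral => t _; rewrite dotpDl dotpZl.
- rewrite mul1r; apply: normr_mean_le; first exact: bm_dotp.
  by move=> t; rewrite (le_trans (dotp_CS _ _)) // ler_piMr.
rewrite (@hilbert_mean_unique P m) ?mP // => h'; split; last exact: mP.
by apply: bm_integrableP; exact: bm_dotp.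
Qed.

Lemma norm_hilbert_mean_le1 (P : probability T R) : `|hilbert_mean P phi| <= 1.
Proof.
set m := hilbert_mean P phi; have [->|m0] := eqVneq m 0; first by rewrite normr0.
have nm0 : 0 < `|m| by rewrite normr_gt0.
rewrite -(ler_pM2l nm0) -expr2 -dotp_norm {2}/m hilbert_meanE mulr1.
apply: (le_trans (ler_norm _)); apply: normr_mean_le; first exact: bm_dotp.
by move=> t; rewrite (le_trans (dotp_CS _ _)) // ler_piMr.
Qed.

(** The bridge from norms to Gram matrices: for the kernel of [phi], the entries of [kext] at [None]
    are inner products with the mean vector, so expanding the squared norm yields
    [bform_devector]. *)
Lemma hilbert_mean_deviation (P : probability T R) n (z : 'I_n -> T) :
  `|hilbert_mean P phi - n%:R^-1 *: \sum_i phi (z i)| =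
  deviation P (fun s t => dotp (phi s) (phi t)) z.
Proof.
rewrite /deviation bform_devector; last exact: pd_kernel_comp (@pd_kernel_dotp _ H).
set m := hilbert_mean P phi.
have mE t : \int[P]_s dotp (phi t) (phi s) = dotp (phi t) m.
  by rewrite hilbert_meanE.
rewrite /=; under [X in _ - _ * X]eq_bigr do rewrite mE.
under eq_Rintegral do rewrite mE dotpC.
rewrite -hilbert_meanE -[LHS]ger0_norm // -sqrtr_sqr -dotp_norm; congr Num.sqrt.
rewrite -dotp_suml; under [X in _ ^+ 2 * X]eq_bigr do rewrite -dotp_sumr.
rewrite -dotp_suml dotpBl !dotpBr !dotpZl !dotpZr (dotpC m (\sum_i _)).
by ring.
Qed.

End hilbert_means.

Section rkhs.
Context (R : realType) d (T : measurableType d) (k : T -> T -> R) (H : rkhs k).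

Lemma dotp_feature x y : dotp (feature H x) (feature H y) = k x y.
Proof. by rewrite rkhs_reproducing rkhs_featureE. Qed.

Lemma norm_feature_le1 : (forall x y, `|k x y| <= 1) -> forall x, `|feature H x| <= 1.
Proof.
move=> k1 x; rewrite -(@ler_pXn2r _ 2) ?nnegrE // expr1n -dotp_norm dotp_feature.
exact: le_trans (ler_norm _) (k1 x x).
Qed.

(* The functions of [H] that are measurable form a closed subspace containing
   the features, and the features are total. *)
Lemma measurable_rkhs : (forall x, measurable_fun setT (k x)) ->
  forall h : H, measurable_fun setT (fun t => dotp h (feature H t)).
Proof.
move=> mk h.
pose W := [set f : H | measurable_fun setT (fun t => dotp f (feature H t))].
(* [m] is the orthogonal projection of [h] on [W]. The features lie in [W], so [m] and [h] are the
   same function. *)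
have [|||||m Wm mh] := @riesz_subspace _ H W (fun f => dotp f h) `|h|.
- by rewrite /W /=; under eq_fun do rewrite dotp0l; exact: measurable_cst.
- move=> a f g Wf Wg; rewrite /W /=; under eq_fun do rewrite dotpDl dotpZl.
  by apply: measurable_funD => //; apply: measurable_funM.
- move=> u l Wu ul; apply: (measurable_fun_cvg Wu) => t _.
  rewrite dotpC; under eq_fun do rewrite dotpC.
  exact: cvg_dotpr.
- by move=> a f g; rewrite dotpDl dotpZl.
- by move=> f; rewrite mulrC; exact: dotp_CS.
suff -> : h = m by [].
apply: (@rkhs_fun_inj _ _ _ H); apply/funext => t.
rewrite -!rkhs_reproducing !(dotpC _ (feature H t)) mh //.
rewrite /W /=; under eq_fun do rewrite dotp_feature; exact: mk.
Qed.

End rkhs.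

Section average_measure_integral.
Context (R : realType) d (T : measurableType d) (n : nat).
Variable m : 'I_n -> {measure set T -> \bar R}.
Hypothesis n_gt0 : (0 < n)%N.
Hypothesis m1 : forall i, m i setT = 1%E.

Let m' (i : nat) : {measure set T -> \bar R} :=
  if insub i is Some j then m j else mzero.

Let n0 : (0 <= n%:R^-1 :> R)%R. Proof. by rewrite invr_ge0. Qed.

Let averageE A : average_measure m A = mscale (NngNum n0) (msum m' n) A.
Proof.
rewrite /average_measure /mscale /msum /=; congr (_ * _)%E.
by apply: eq_bigr => i _; rewrite /m' valK.
Qed.

Lemma integral_average (f : T -> \bar R) :
  (forall t, 0 <= f t)%E -> measurable_fun setT f ->
  (\int[average_measure m]_t f t = (n%:R^-1)%:E * \sum_i \int[m i]_t f t)%E.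
Proof.
move=> f0 mf; rewrite (eq_measure_integral (mscale (NngNum n0) (msum m' n))).
  rewrite ge0_integral_mscale // ge0_integral_measure_sum //=.
  by congr (_ * _)%E; apply: eq_bigr => i _; rewrite /m' valK.
by move=> A _ _; exact: averageE.
Qed.

Lemma average_measureT : average_measure m setT = 1%E.
Proof.
rewrite /average_measure (eq_bigr (fun=> 1%E)) //.
rewrite sumEFin sumr_const card_ord -EFinM -[_ *+ n]mulr_natl mulr1 mulVf //.
by rewrite pnatr_eq0 -lt0n.
Qed.

Lemma Rintegral_average (f : T -> R) : bounded_measurable f ->
  \int[average_measure m]_t f t = n%:R^-1 * \sum_i \int[m i]_t f t.
Proof.
move=> bf; have [mf [M fM]] := bf.
have intf (mu : {measure set T -> \bar R}) g : mu setT = 1%E ->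
    bounded_measurable g -> mu.-integrable setT (EFin \o g).
  by move=> mu1; apply: bm_integrable; rewrite mu1 ltry.
have bM : bounded_measurable (fun _ : T => M) by exact: bm_cst.
have shift (mu : {measure set T -> \bar R}) : mu setT = 1%E ->
    \int[mu]_t (f t + M) = \int[mu]_t f t + M.
  move=> mu1; rewrite RintegralD //; [|exact: intf|exact: intf].
  by rewrite Rintegral_cst // mu1 mulr1.
have nE : n%:R^-1 * \sum_(i < n) M = M.
  rewrite sumr_const card_ord -[M *+ n]mulr_natl mulrA mulVf ?mul1r //.
  by rewrite pnatr_eq0 -lt0n.
apply: (addIr M) => /=; rewrite -(shift _ average_measureT).
transitivity (n%:R^-1 * \sum_i (\int[m i]_t f t + M)); last first.
  by rewrite big_split /= mulrDr nE.
rewrite [LHS]/Rintegral integral_average; last 2 first.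
- move=> t; rewrite lee_fin -lerBlDr sub0r.
  by have := fM t; rewrite ler_norml => /andP[].
- by apply/measurable_EFinP; exact: measurable_funD.
rewrite (eq_bigr (fun i => (\int[m i]_t f t + M)%:E)); first by rewrite sumEFin.
move=> i _; rewrite -shift // /Rintegral fineK //.
apply: integrable_fin_num => //; apply: (intf _ (fun t => f t + M)) => //.
exact: bmD.
Qed.

End average_measure_integral.

(** * Embedding of the model *)

Lemma Rintegral_dirac (R : realType) d (T : measurableType d) (a : T)
    (f : T -> R) : measurable_fun setT f -> \int[\d_a]_t f t = f a.
Proof.
move=> mf; rewrite /Rintegral integral_dirac //; last exact/measurable_EFinP.
by rewrite diracT mul1e.
Qed.

Section model.
Context (R : realType) d1 d2 (S : measurableType d1) (T : measurableType d2).
Variables (k : S * T -> S * T -> R) (H : rkhs k).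
Hypothesis mk : measurable_fun setT (fun p : (S * T) * (S * T) => k p.1 p.2).
Hypothesis k1 : forall z z', `|k z z'| <= 1.

Local Notation phi := (feature H).

Let mphi (h : H) : measurable_fun setT (fun z => dotp h (phi z)).
Proof.
apply: measurable_rkhs => z.
exact: (measurableT_comp mk (pair1_measurable z)).
Qed.

Let phi1 z : `|phi z| <= 1. Proof. exact: norm_feature_le1. Qed.

Lemma mean_embedding_empirical n (z : 'I_n -> S * T) : (0 < n)%N ->
  mean_embedding H (empirical_measure R z) = n%:R^-1 *: \sum_i phi (z i).
Proof.
move=> n0; have d1' i : (\d_(z i) : {measure set (S * T) -> \bar R}) setT = 1%E.
  exact: diracT.
apply: hilbert_mean_unique => h; have bh := bm_dotp mphi phi1 h; split.
  by apply: bm_integrable bh; rewrite [ltLHS]average_measureT // ltry.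
rewrite dotpZr dotp_sumr [RHS]Rintegral_average //; congr (_ * _).
by apply: eq_bigr => i _; rewrite Rintegral_dirac.
Qed.

Lemma mmd_empirical (P : probability (S * T)%type R) n (z : 'I_n -> S * T) :
  (0 < n)%N -> mmd H (empirical_measure R z) P = deviation P k z.
Proof.
move=> n0; rewrite /mmd distrC mean_embedding_empirical //.
have kE : (fun x y => dotp (phi x) (phi y)) = k.
  by apply/funext => x; apply/funext => y; exact: dotp_feature.
rewrite /mean_embedding.
have E2 := congr1 (fun k' => deviation P k' z) kE.
have E := hilbert_mean_deviation mphi phi1 P z.
rewrite E.
exact: E2.
Qed.

Variable K : S -> probability T R.
Hypothesis mK : forall U, measurable U -> measurable_fun setT (fun s => K s U).

(** Embedding of [\d_s \x K s], the contribution of one covariate to the empirical model. *)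
Definition fiber_mean (s : S) : H := hilbert_mean (K s) (fun t => phi (s, t)).

Local Notation psi := fiber_mean.

Let mphis s (h : H) : measurable_fun setT (fun t => dotp h (phi (s, t))).
Proof. exact: (measurableT_comp (mphi h) (pair1_measurable s)). Qed.

Lemma fiber_meanE s h : dotp h (psi s) = \int[K s]_t dotp h (phi (s, t)).
Proof. exact: hilbert_meanE. Qed.

Lemma norm_fiber_mean_le1 s : `|psi s| <= 1.
Proof. exact: norm_hilbert_mean_le1. Qed.

Lemma measurable_fiber_mean h : measurable_fun setT (fun s => dotp h (psi s)).
Proof.
under eq_fun do rewrite fiber_meanE.
exact: (bm_mean_kernel (bm_dotp mphi phi1 h) mK).1.
Qed.

Lemma mean_embedding_model_empirical n (z : 'I_n -> S * T) : (0 < n)%N ->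
  mean_embedding H (model_empirical_measure K z) =
  n%:R^-1 *: \sum_i psi (z i).1.
Proof.
move=> n0; have mT i :
    ((\d_((z i).1) \x K (z i).1)%E : {measure set (S * T) -> \bar R}) setT = 1%E.
  exact: (probability_setT
    ((\d_((z i).1) \x K (z i).1)%E : probability (S * T)%type R)).
apply: hilbert_mean_unique => h; have bh := bm_dotp mphi phi1 h; split.
  by apply: bm_integrable bh; rewrite [ltLHS]average_measureT // ltry.
rewrite dotpZr dotp_sumr [RHS]Rintegral_average //; congr (_ * _).
apply: eq_bigr => i _; rewrite [RHS](mean_prod bh (\d_((z i).1)) (K (z i).1)).
by rewrite Rintegral_dirac ?fiber_meanE //; exact: (bm_mean bh _).1.
Qed.

Variables (P Q : probability (S * T)%type R).
Hypothesis QE : joint_law (marginal1 P) K Q.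

Let mpsi1 h : measurable_fun setT (fun z : S * T => dotp h (psi z.1)).
Proof. exact: (measurableT_comp (measurable_fiber_mean h) measurable_fst). Qed.

Let psi1 (z : S * T) : `|psi z.1| <= 1. Proof. exact: norm_fiber_mean_le1. Qed.

(** Taking the mean over pairs, through [z.1], rather than over covariates expresses the model's
    deviation with the same law [P] and the same i.i.d. pairs as that of the empirical measure. *)
Lemma mean_embedding_joint :
  mean_embedding H Q = hilbert_mean P (fun z => psi z.1).
Proof.
apply: dotp_inj => h; rewrite !hilbert_meanE //.
rewrite (mean_disintegration mK QE (bm_dotp mphi phi1 h)).
rewrite (mean_distribution P); last exact: (bm_mean_kernel (bm_dotp mphi phi1 h) mK).
by apply: eq_Rintegral => z _; rewrite fiber_meanE.
Qed.

Definition fiber_kernel (z z' : S * T) : R := dotp (psi z.1) (psi z'.1).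

Lemma mmd_model n (z : 'I_n -> S * T) : (0 < n)%N ->
  mmd H Q (model_empirical_measure K z) = deviation P fiber_kernel z.
Proof.
move=> n0; rewrite /mmd mean_embedding_joint mean_embedding_model_empirical //.
exact: (hilbert_mean_deviation mpsi1 psi1).
Qed.

Lemma pd_fiber_kernel : pd_kernel fiber_kernel.
Proof. exact: pd_kernel_comp (fun z : S * T => psi z.1) _ (@pd_kernel_dotp _ H). Qed.

Lemma fiber_kernel_le1 z z' : `|fiber_kernel z z'| <= 1.
Proof.
by rewrite (le_trans (dotp_CS _ _)) // mulr_ile1.
Qed.

Lemma measurable_fiber_kernel :
  measurable_fun setT (fun p : (S * T) * (S * T) => fiber_kernel p.1 p.2).
Proof.
have bk : bounded_measurable (fun p : (S * T) * (S * T) => k p.1 p.2).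
  by split => //; exists 1 => p; exact: k1.
(* The variables are reordered so that the one to be integrated always comes last: [bm_mean_kernel]
   removes the second response, then the first. *)
pose f1 (p : ((S * S) * T) * T) := k (p.1.1.1, p.1.2) (p.1.1.2, p.2).
have bf1 : bounded_measurable f1.
  apply: (bm_comp bk (h := fun p : ((S * S) * T) * T =>
    ((p.1.1.1, p.1.2), (p.1.1.2, p.2)))).
  have m11 : measurable_fun setT (fun p : ((S * S) * T) * T => p.1.1).
    exact: measurableT_comp measurable_fst measurable_fst.
  apply: measurable_fun_pair; apply: measurable_fun_pair.
  - exact: measurableT_comp measurable_fst m11.
  - exact: measurableT_comp measurable_snd measurable_fst.
  - exact: measurableT_comp measurable_snd m11.
  - exact: measurable_snd.
have mK1 U : measurable U -> measurable_fun setT (fun p : (S * S) * T => K p.1.2 U).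
  move=> mU; apply: (measurableT_comp (mK mU)).
  exact: measurableT_comp measurable_snd measurable_fst.
have bf2 := bm_mean_kernel bf1 mK1.
have mK2 U : measurable U -> measurable_fun setT (fun p : S * S => K p.1 U).
  by move=> mU; exact: measurableT_comp (mK mU) measurable_fst.
have bf3 := bm_mean_kernel bf2 mK2.
rewrite (_ : (fun p => _) = (fun p : S * S =>
    \int[K p.1]_y \int[K p.2]_y' f1 ((p, y), y')) \o
    (fun p : (S * T) * (S * T) => (p.1.1, p.2.1))); last first.
  apply/funext => p; rewrite /fiber_kernel dotpC fiber_meanE /=.
  apply: eq_Rintegral => y _; rewrite dotpC fiber_meanE.
  by apply: eq_Rintegral => y' _; rewrite dotp_feature.
apply: measurableT_comp bf3.1 _; apply: measurable_fun_pair.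
  exact: measurableT_comp measurable_fst measurable_fst.
exact: measurableT_comp measurable_fst measurable_snd.
Qed.

End model.

(** [kext] is linear in the kernel, so the extension of the difference is the difference of the
    extensions; its positivity at [devector z] is the inequality between squared deviations. *)
Lemma le_deviation (R : realType) d (T : measurableType d) (P : probability T R)
    (k k' : T -> T -> R) (c : R) n (z : 'I_n -> T) :
  bounded_measurable (fun p : T * T => k p.1 p.2) ->
  bounded_measurable (fun p : T * T => k' p.1 p.2) ->
  0 <= c -> pd_kernel (fun s t => c ^+ 2 * k s t - k' s t) ->
  deviation P k' z <= c * deviation P k z.
Proof.
move=> bk bk' c0 pdB.
have bB : bounded_measurable (fun p : T * T => c ^+ 2 * k p.1 p.2 - k' p.1 p.2).
  by apply: bmB => //; exact: bmZ.
have [M BM] := bB.2.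
have pdK := pd_kext P pdB bB.1 (fun s t => BM (s, t)).
have bs s := bm_pair1 bk s; have bs' s := bm_pair1 bk' s.
have bm := bm_mean bk P; have bm' := bm_mean bk' P.
have BE : kext P (fun s t => c ^+ 2 * k s t - k' s t) =
    (fun x y => c ^+ 2 * kext P k x y - kext P k' x y).
  have E s : \int[P]_t (c ^+ 2 * k s t - k' s t) =
      c ^+ 2 * \int[P]_t k s t - \int[P]_t k' s t.
    by rewrite meanB ?meanZ //; [exact: bs|exact/bmZ/bs|exact: bs'].
  apply/funext => -[s|]; apply/funext => -[t|] //=.
  under eq_Rintegral do rewrite E.
  by rewrite meanB ?meanZ //; [exact: bmZ].
rewrite /deviation -[c in leRHS]ger0_norm // -sqrtr_sqr -sqrtrM ?sqr_ge0 //.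
apply: ler_wsqrtr; rewrite -subr_ge0 -bformBk -BE.
exact: bform_ge0.
Qed.

Lemma norm_le_opnorm (R : realType) (V W : normedModType R) (f : {linear V -> W})
    (v : V) : bounded_fun_norm f -> `|f v| <= opnorm f * `|v|.
Proof.
move=> /(_ 1)[M fM]; have ubf : has_ubound [set `|f v| | v in [set v : V | `|v| <= 1]].
  by exists M => _ [u /= u1 <-]; exact: fM.
have [->|v0] := eqVneq v 0; first by rewrite linear0 !normr0 mulr0.
have nv : 0 < `|v| by rewrite normr_gt0.
rewrite -ler_pdivrMr //; apply: ub_le_sup => //.
exists (`|v|^-1 *: v); first by rewrite /= normrZ gtr0_norm ?invr_gt0 // mulVf ?gt_eqF.
by rewrite linearZ normrZ gtr0_norm ?invr_gt0 // mulrC.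
Qed.

Lemma opnorm_ge0 (R : realType) (V W : normedModType R) (f : {linear V -> W}) :
  bounded_fun_norm f -> 0 <= opnorm f.
Proof.
move=> /(_ 1)[M fM]; apply: ub_le_sup; first by exists M => _ [u /= u1 <-]; exact: fM.
by exists 0; [rewrite /= normr0|rewrite linear0 normr0].
Qed.

(** * Domination of the model kernel through the embedding operator *)

Section tensor_model.
Context (R : realType) d1 d2 (S : measurableType d1) (T : measurableType d2).
Variables (kS : S -> S -> R) (kT : T -> T -> R) (k : S * T -> S * T -> R).
Variables (HS : rkhs kS) (HT : rkhs kT) (H : rkhs k).
Hypothesis kE : k = tensor_kernel kS kT.
Hypothesis mk : measurable_fun setT (fun p : (S * T) * (S * T) => k p.1 p.2).
Hypothesis k1 : forall z z', `|k z z'| <= 1.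
Hypothesis kS1 : forall x x', `|kS x x'| <= 1.
Hypothesis mkT : forall y, measurable_fun setT (kT y).
Hypothesis kT1 : forall y y', `|kT y y'| <= 1.

Local Notation phiS := (feature HS).
Local Notation phiT := (feature HT).

Lemma pd_rkhs (U : Type) (k' : U -> U -> R) (H' : rkhs k') : pd_kernel k'.
Proof.
rewrite (_ : k' = fun x y => dotp (feature H' x) (feature H' y)).
  exact: pd_kernel_comp (@pd_kernel_dotp _ H').
by apply/funext => x; apply/funext => y; rewrite rkhs_reproducing rkhs_featureE.
Qed.

Section embedding_operator.
Variable K : S -> probability T R.
Hypothesis mK : forall U, measurable U -> measurable_fun setT (fun s => K s U).
Variable C : {linear HS -> HT}.
Hypothesis C_cme : cond_mean_embedding K C.
Hypothesis C_bounded : bounded_fun_norm C.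

(** The product form of [k] lets [kS] leave the double integral over the two fibres; the remaining
    double mean of [kT] is the inner product of the two conditional embeddings. *)
Lemma fiber_kernel_cme z z' : fiber_kernel H K z z' =
  kS z.1 z'.1 * dotp (C (phiS z.1)) (C (phiS z'.1)).
Proof.
have mHT (h : HT) : measurable_fun setT (fun y => dotp h (phiT y)).
  exact: measurable_rkhs.
have HT1 y : `|phiT y| <= 1 by exact: norm_feature_le1.
rewrite /fiber_kernel !C_cme fiber_meanE // [X in _ = _ * X]hilbert_meanE //.
rewrite -meanZ; last exact: (bm_dotp mHT HT1).
apply: eq_Rintegral => y' _; rewrite dotpC fiber_meanE // (dotpC (mean_embedding _ _)).
rewrite [X in _ * X]hilbert_meanE // -meanZ; last exact: (bm_dotp mHT HT1).
apply: eq_Rintegral => y _; rewrite !dotp_feature kE /tensor_kernel /=.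
by rewrite (pd_rkhs HS).1.
Qed.

(** At a weighted list the form is [(opnorm C * |v|) ^ 2 - |C v| ^ 2], with [v] the corresponding
    combination of features. *)
Lemma pd_opnorm : pd_kernel (fun x x' =>
  opnorm C ^+ 2 * kS x x' - dotp (C (phiS x)) (C (phiS x'))).
Proof.
apply: pd_kernelP => [x y|l]; first by rewrite (pd_rkhs HS).1 dotpC.
rewrite bformBk; pose v := \sum_(p <- l) p.1 *: phiS p.2.
have -> : bform kS l l = `|v| ^+ 2.
  rewrite -dotp_norm dotp_suml; apply: eq_bigr => p _.
  rewrite dotp_sumr; apply: eq_bigr => q _.
  by rewrite dotpZl dotpZr dotp_feature mulrA.
have -> : bform (fun x x' => dotp (C (phiS x)) (C (phiS x'))) l l = `|C v| ^+ 2.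
  rewrite -dotp_norm linear_sum dotp_suml; apply: eq_bigr => p _.
  rewrite dotp_sumr; apply: eq_bigr => q _.
  by rewrite !linearZ dotpZl dotpZr mulrA.
rewrite subr_ge0 -exprMn ler_pXn2r ?nnegrE ?mulr_ge0 ?opnorm_ge0 //.
exact: norm_le_opnorm.
Qed.

Lemma pd_dominate_fiber : pd_kernel (fun z z' : S * T =>
  opnorm C ^+ 2 * kS z.1 z'.1 ^+ 2 - fiber_kernel H K z z').
Proof.
rewrite (_ : (fun z z' => _) = fun z z' : S * T => kS z.1 z'.1 *
    (opnorm C ^+ 2 * kS z.1 z'.1 - dotp (C (phiS z.1)) (C (phiS z'.1)))).
  apply: (pd_kernelM (pd_kernel_comp (fun z : S * T => z.1) (pd_rkhs HS))).
  exact: (pd_kernel_comp (fun z : S * T => z.1) pd_opnorm).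
by apply/funext => z; apply/funext => z'; rewrite fiber_kernel_cme; ring.
Qed.

Lemma fiber_kernel_eq0 : (forall y, kT y y = 0) -> fiber_kernel H K = (fun _ _ => 0).
Proof.
move=> kT0; apply/funext => z; apply/funext => z'; rewrite fiber_kernel_cme.
have kT00 y y' : kT y y' = 0.
  apply/eqP; rewrite -sqrf_eq0 eq_le sqr_ge0 andbT.
  by have := pd_kernel_CS y y' (pd_rkhs HT); rewrite !kT0 mul0r.
have CE x : C (phiS x) = 0.
  apply: (@rkhs_fun_inj _ _ _ HT); apply/funext => y.
  rewrite -!rkhs_reproducing dotp0l C_cme dotpC hilbert_meanE.
  - rewrite -[RHS](mean_cst (K x) 0); apply: eq_Rintegral => y' _.
    by rewrite dotp_feature kT00.
  - exact: measurable_rkhs.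
  - exact: norm_feature_le1.
by rewrite CE dotp0l mulr0.
Qed.

End embedding_operator.

(* When [kT] vanishes, [kS] need not be measurable, but the model kernel is 0. *)
Lemma dominating_kernel : exists G : S * T -> S * T -> R,
  [/\ pd_kernel G,
      measurable_fun setT (fun p : (S * T) * (S * T) => G p.1 p.2),
      forall z z', `|G z z'| <= 1 &
      forall (K : S -> probability T R) (C : {linear HS -> HT}),
        (forall U, measurable U -> measurable_fun setT (fun s => K s U)) ->
        cond_mean_embedding K C -> bounded_fun_norm C ->
        forall (P : probability (S * T)%type R) n (z : 'I_n -> S * T),
          deviation P (fiber_kernel H K) z <= opnorm C * deviation P G z].
Proof.
have bf (K : S -> probability T R) :
    (forall U, measurable U -> measurable_fun setT (fun s => K s U)) ->
    bounded_measurable (fun p : (S * T) * (S * T) => fiber_kernel H K p.1 p.2).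
  move=> mK; split; first exact: measurable_fiber_kernel.
  by exists 1 => p; exact: fiber_kernel_le1.
have [kT0|/existsNP[y0 kTy0]] := pselect (forall y, kT y y = 0).
  exists (fun _ _ => 0); split.
  - exact: pd_kernel0.
  - exact: measurable_cst.
  - by move=> z z'; rewrite normr0.
  - move=> K C mK C_cme C_bounded P n z; apply: le_deviation.
    + exact: bm_cst.
    + exact: bf.
    + exact: opnorm_ge0.
    + rewrite (fiber_kernel_eq0 C_cme) // mulr0 subr0; exact: pd_kernel0.
pose G (z z' : S * T) := kS z.1 z'.1 ^+ 2.
have mG : measurable_fun setT (fun p : (S * T) * (S * T) => G p.1 p.2).
  (* Freezing both responses at [y0], where [kT] does not vanish, recovers [kS] from [k], so
     measurability for the product sigma-algebra is inherited from [k]. *)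
  rewrite (_ : (fun p => _) = fun p : (S * T) * (S * T) =>
      ((kT y0 y0)^-1 * k (p.1.1, y0) (p.2.1, y0)) ^+ 2); last first.
    apply/funext => p; rewrite /G kE /tensor_kernel /= mulrC mulfK //.
    exact/eqP.
  apply: measurable_funX; apply: measurable_funM; first exact: measurable_cst.
  have m2 (f : (S * T) * (S * T) -> S * T) : measurable_fun setT f ->
      measurable_fun setT (fun p => ((f p).1, y0)).
    move=> mf; apply: measurable_fun_pair; last exact: measurable_cst.
    exact: measurableT_comp measurable_fst mf.
  apply: (measurableT_comp mk (g := fun p : (S * T) * (S * T) =>
    ((p.1.1, y0), (p.2.1, y0)))).
  apply: measurable_fun_pair; [apply: (m2 fst)|apply: (m2 snd)].
    exact: measurable_fst.
  exact: measurable_snd.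
have G1 z z' : `|G z z'| <= 1 by rewrite normrX expr_le1.
exists G; split => //.
  rewrite (_ : G = fun z z' => kS z.1 z'.1 * kS z.1 z'.1).
    by apply: pd_kernelM; exact: (pd_kernel_comp (fun z : S * T => z.1) (pd_rkhs HS)).
  by apply/funext => z; apply/funext => z'.
move=> K C mK C_cme C_bounded P n z; apply: le_deviation.
- by split => //; exists 1 => p; exact: G1.
- exact: bf.
- exact: opnorm_ge0.
- exact: pd_dominate_fiber.
Qed.

End tensor_model.

(** * Contamination, aggregation of the deviations and conclusion *)

Lemma contamination_mean (R : realType) (T : Type) (V : normedModType R)
    (phi : T -> V) (eps : R) n (z0 z : 'I_n -> T) :
  (forall t, `|phi t| <= 1) -> contamination eps z0 z ->
  `|n%:R^-1 *: \sum_i phi (z i) - n%:R^-1 *: \sum_i phi (z0 i)| <= 2 * eps.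
Proof.
move=> phi1 [I [Ieps zz0]]; rewrite -scalerBr -sumrB normrZ ger0_norm ?invr_ge0 //.
have sumI : `|\sum_i (phi (z i) - phi (z0 i))| <= 2 * #|I|%:R.
  rewrite (bigID (mem I)) /= [X in _ + X]big1 ?addr0; last first.
    by move=> i /zz0 ->; rewrite subrr.
  rewrite (le_trans (ler_norm_sum _ _ _)) //.
  apply: (@le_trans _ _ (\sum_(i in I) 2)); last by rewrite sumr_const mulr_natr.
  by apply: ler_sum => i _; rewrite (le_trans (ler_normB _ _)) // (lerD (phi1 _)).
rewrite (le_trans (ler_wpM2l _ sumI)) ?invr_ge0 // mulrCA ler_wpM2l //.
by rewrite mulrC.
Qed.

Section aggregation.
Context (R : realType) d (Om : measurableType d) (Pr : probability Om R).
Variable n : nat.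
Hypothesis n_gt0 : (0 < n)%N.

Let r : R := Num.sqrt n%:R.
Let r_gt0 : 0 < r. Proof. by rewrite sqrtr_gt0 ltr0n. Qed.

(** All that the two final bounds use of a deviation, which reduces aggregation to abstract random
    variables. *)
Definition concentrated (f : Om -> R) :=
  [/\ bounded_measurable f, \int[Pr]_w f w <= r^-1 &
    forall x, 0 <= x ->
      (Pr [set w | (r^-1 * (1 + Num.sqrt (2 * x)) <= f w)%R] <= (expR (- x))%:E)%E].

Lemma deviation_concentrated d' (T : measurableType d') (P : probability T R)
    (k : T -> T -> R) (Z : 'I_n -> {mfun Om >-> T}) :
  pd_kernel k -> measurable_fun setT (fun z : T * T => k z.1 z.2) ->
  (forall s t, `|k s t| <= 1) -> iid Pr P Z ->
  concentrated (fun w => deviation P k (fun i => Z i w)).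
Proof.
move=> pdk mk k1 Z_iid; split; first exact: bm_deviation_sample.
  exact: mean_deviation_le.
by move=> x x0; exact: deviation_tail.
Qed.

Variables (Theta : Type) (th0 : Theta) (D : Theta -> R) (X U V : Om -> R).
Variables (B : Theta -> Om -> R) (c e : R).
Hypothesis D_ge0 : forall th, 0 <= D th.
Hypothesis c_ge0 : 0 <= c.
Hypothesis cU : concentrated U.
Hypothesis cV : concentrated V.
Hypothesis cB : forall th, concentrated (B th).
Hypothesis le_X : forall th w, X w <= e + D th + c * U w + 2 * V w + B th w.

Let infD : has_inf (range D).
Proof. by split; [exists (D th0), th0|exists 0 => _ [th _ <-]]. Qed.

Let near_inf (a : R) : 0 < a -> exists th, D th < inf (range D) + a.
Proof. by move=> a0; have [_ [th _ <-] h] := inf_adherent a0 infD; exists th. Qed.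

Lemma outer_expectation_bound :
  (outer_expectation Pr X <= (e + inf (range D) + (c + 3) / r)%:E)%E.
Proof.
apply/lee_addgt0Pr => a a0; have [th Dth] := near_inf a0.
have [bU mU _] := cU; have [bV mV _] := cV; have [bB mB _] := cB th.
(* [X] need not be measurable; [Y] is a measurable majorant, hence admissible in the upper integral.
   The weights [c], 2 and 1 of the deviations add up to [c + 3]. *)
pose Y w := e + D th + c * U w + 2 * V w + B th w.
have b1 : bounded_measurable (fun w => e + D th + c * U w).
  by apply: bmD; [exact: bm_cst|exact: bmZ].
have b2 : bounded_measurable (fun w => e + D th + c * U w + 2 * V w).
  by apply: bmD => //; exact: bmZ.
have bY : bounded_measurable Y by exact: bmD.
apply: (@le_trans _ _ (\int[Pr]_w (Y w)%:E)%E).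
  apply: ereal_inf_lbound; exists (EFin \o Y) => //; split.
    by apply/measurable_EFinP; exact: bY.1.
  by move=> w; rewrite lee_fin; exact: le_X.
rewrite -EFin_mean // -EFinD lee_fin /Y.
rewrite meanD // meanD //; last exact: bmZ.
rewrite meanD ?mean_cst; [|exact: bm_cst|exact: bmZ].
rewrite !meanZ // (mulrDl c 3).
have := ler_wpM2l c_ge0 mU; have := mV; have := mB; move: Dth.
set ri := r^-1; set p := c * ri; set q := c * Rintegral _ _ _; lra.
Qed.

Lemma inner_probability_bound (eta : R) : 0 < eta < 1 ->
  ((1 - eta)%:E <= inner_probability Pr
    [set w | (X w < e + inf (range D) +
      r^-1 * (c + 3) * (1 + Num.sqrt (2 * ln (4 / eta))))%R])%E.
Proof.
move=> /andP[eta0 eta1]; pose x := ln (3 / eta).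
have eta3 : 1 < 3 / eta by rewrite ltr_pdivlMr // mul1r; lra.
have x0 : 0 <= x by rewrite ln_ge0 // ltW.
have ex : expR (- x) = eta / 3.
  by rewrite expRN lnK ?posrE ?divr_gt0 // invf_div.
have c3 : 0 < r^-1 * (c + 3) by rewrite mulr_gt0 ?invr_gt0 ?ltr_wpDl.
have x4 : Num.sqrt (2 * x) < Num.sqrt (2 * ln (4 / eta)).
  have lx : x < ln (4 / eta).
    by rewrite ltr_ln ?posrE ?divr_gt0 // ltr_pM2r ?invr_gt0 // ltr_nat.
  have l2x : 2 * x < 2 * ln (4 / eta) by rewrite ltr_pM2l.
  by rewrite ltr_sqrt // (le_lt_trans _ l2x) // mulr_ge0.
pose a := r^-1 * (1 + Num.sqrt (2 * x)).
(* The exact gain from replacing 3 by 4 in the logarithm, all of it granted to the approximate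
   minimizer [th]. *)
pose s := r^-1 * (c + 3) * (Num.sqrt (2 * ln (4 / eta)) - Num.sqrt (2 * x)).
have [th Dth] : exists th, D th < inf (range D) + s.
  by apply: near_inf; rewrite mulr_gt0 // subr_gt0.
pose F := [:: U; V; B th].
pose bad f : set Om := [set w | a <= f w].
have [bU _ tU] := cU; have [bV _ tV] := cV; have [bB _ tB] := cB th.
have mbad f : bounded_measurable f -> measurable (bad f).
  by move=> bf; exact: measurable_superlevel bf.1.
pose A := ~` (bad U `|` bad V `|` bad (B th)).
have mUVB : measurable (bad U `|` bad V `|` bad (B th)).
  by apply: measurableU; [apply: measurableU|]; exact: mbad.
have PA : ((1 - eta)%:E <= Pr A)%E.
  rewrite probability_setC // EFinB leeB // (le_trans (measureU2 _ _ _)) //.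
  - by apply: measurableU; exact: mbad.
  - exact: mbad.
  have -> : eta = eta / 3 + eta / 3 + eta / 3 by field.
  rewrite !EFinD; apply: leeD; last by rewrite -ex; exact: tB.
  rewrite (le_trans (measureU2 _ _ _)) //; [exact: mbad|exact: mbad|].
  by apply: leeD; rewrite -ex; [exact: tU|exact: tV].
apply: (le_trans PA); apply: ereal_sup_ubound; exists A => //; split.
  exact: measurableC.
have nbad f w : (~` bad f) w -> f w < a by move=> /negP; rewrite -ltNge.
move=> w; rewrite /A !setCU => -[[/nbad Uw /nbad Vw] /nbad Bw].
apply: (le_lt_trans (le_X th w)).
(* Not strict, as [c] may be 0; strictness comes from the other terms. *)
have cUw : c * U w <= c * a by rewrite ler_wpM2l // ltW.
have <- : c * a + 2 * a + a + s =
    r^-1 * (c + 3) * (1 + Num.sqrt (2 * ln (4 / eta))) by rewrite /a /s; ring.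
move: cUw Vw Bw Dth; rewrite -/a; set p := c * U w; set q := c * a.
by clearbody p q; lra.
Qed.

End aggregation.

(** Suffix 0 is for clean data and 1 for contaminated; [e] is the empirical measure, [f] an
    empirical model, [m] an exact one, and [h] marks the estimator. The passage between clean and
    contaminated data occurs four times at cost [2 * a]: once for each empirical model and twice for
    [e], which stands on both sides of the minimality inequality. For the same reason the distance
    from [e0] to [p] is counted twice. *)
Lemma minimizer_le (R : realType) (V : normedModType R) (p mh m : V)
    (e0 e1 fh0 fh1 f0 f1 : V) (a u : R) :
  `|e1 - e0| <= 2 * a -> `|fh1 - fh0| <= 2 * a -> `|f1 - f0| <= 2 * a ->
  `|fh1 - e1| <= `|f1 - e1| -> `|mh - fh0| <= u ->
  `|mh - p| <= 8 * a + `|m - p| + u + 2 * `|e0 - p| + `|m - f0|.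
Proof.
move=> ea fha fa fe fu.
have h1 := ler_distD fh0 mh p; have h2 := ler_distD fh1 fh0 p.
have h3 := ler_distD e1 fh1 p; have h4 := ler_distD e0 e1 p.
have h5 := ler_distD f0 f1 e1; have h6 := ler_distD m f0 e1.
have h7 := ler_distD p m e1; have h8 := ler_distD e0 p e1.
rewrite (distrC fh0 fh1) in h2; rewrite (distrC f0 m) in h6.
rewrite (distrC p e0) (distrC e0 e1) in h8.
lra.
Qed.

Theorem lemma4 (R : realType) (X Y : ptopologicalType)
  (* kernels and their RKHSs *)
  (kX : X -> X -> R) (kY : Y -> Y -> R)
  (kX_kernel : pd_kernel kX) (kY_kernel : pd_kernel kY)
  (kX_cont : continuous (fun p : X * X => kX p.1 p.2))
  (kY_cont : continuous (fun p : Y * Y => kY p.1 p.2))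
  (kX_le1 : forall x x', `|kX x x'| <= 1)
  (kY_le1 : forall y y', `|kY y y'| <= 1)
  (k : borel X * borel Y -> borel X * borel Y -> R)
  (kE : k = tensor_kernel kX kY)
  (k_meas : measurable_fun setT
     (fun p : (borel X * borel Y) * (borel X * borel Y) => k p.1 p.2))
  (k_le1 : forall z z', `|k z z'| <= 1)
  (HX : @rkhs R (borel X) kX) (HY : @rkhs R (borel Y) kY) (H : rkhs k)
  (* model *)
  (Lam : Type) (Pfam : Lam -> probability (borel Y) R)
  (Theta : ptopologicalType) (Theta_polish : polish R Theta)
  (g : Theta -> X -> Lam)
  (g_meas : forall (th : Theta) (A : set (borel Y)), measurable A ->
     measurable_fun setT (fun x : borel X => Pfam (g th x) A))
  (P0 : probability (borel X * borel Y)%type R)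
  (Pjoint : Theta -> probability (borel X * borel Y)%type R)
  (Pjoint_law : forall th : Theta,
     joint_law (marginal1 P0) (fun x => Pfam (g th x)) (Pjoint th))
  (* conditional mean embedding operators *)
  (C : Theta -> {linear HX -> HY})
  (C_bounded : forall th, bounded_fun_norm (C th))
  (C_cme : forall th,
     cond_mean_embedding (fun x => Pfam (g th x)) (C th))
  (C_sup : has_ubound (range (fun th => opnorm (C th))))
  (* sample, contamination and estimator *)
  (d : measure_display) (Om : measurableType d) (Pr : probability Om R)
  (n : nat) (n_gt0 : (0 < n)%N) (eps : R)
  (Z0 Z : 'I_n -> {mfun Om >-> (borel X * borel Y)%type})
  (Z0_iid : iid Pr P0 Z0)
  (Z_contam : forall w, contamination eps (fun i => Z0 i w) (fun i => Z i w))
  (thn : {mfun Om >-> borel Theta})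
  (thn_argmin : forall w,
     mmd_estimate H (fun th x => Pfam (g th x)) (fun i => Z i w) (thn w)) :
  let frakC := sup (range (fun th => opnorm (C th))) in
  let risk := inf (range (fun th => mmd H (Pjoint th) P0)) in
  (outer_expectation Pr (fun w => mmd H (Pjoint (thn w)) P0) <=
     (8 * eps + risk + (frakC + 3) / Num.sqrt n%:R)%:E)%E /\
  forall eta : R, 0 < eta < 1 ->
    ((1 - eta)%:E <= inner_probability Pr
       [set w | (mmd H (Pjoint (thn w)) P0 <
          8 * eps + risk + (Num.sqrt n%:R)^-1 * (frakC + 3) *
            (1 + Num.sqrt (2 * ln (4 / eta))))%R])%E.
Proof.
(* Continuity of [kY] enters through its sections, which are Borel; this makes all functions of [HY]
   measurable. *)
have mkY (y : borel Y) : measurable_fun setT (kY y : borel Y -> R).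
  have cY : continuous (kY y).
    move=> y'; apply: (@continuous_comp _ _ _ (fun y' : Y => (y, y'))
      (fun p : Y * Y => kY p.1 p.2)); last exact: kY_cont.
    by apply: cvg_pair; [exact: cvg_cst|exact: cvg_id].
  apply: (measurability _ (RGenOpens.measurableE R)) => _ [_ [a [b ->]] <-].
  rewrite setTI; apply: sub_sigma_algebra.
  by move/continuousP : cY; apply; exact: interval_open.
have [G [pdG mG G1 domG]] := @dominating_kernel R _ _ (borel X) (borel Y) kX kY k
  HX HY H kE k_meas k_le1 kX_le1 mkY kY_le1.
move=> frakC risk.
pose K th (x : borel X) := Pfam (g th x).
have mK th U : measurable U -> measurable_fun setT (fun x => K th x U).
  exact: g_meas.
have opC th : opnorm (C th) <= frakC.
  by apply: ub_le_sup => //; exists th.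
have frakC0 : 0 <= frakC.
  exact: le_trans (opnorm_ge0 (C_bounded point)) (opC point).
pose U w := deviation P0 G (fun i => Z0 i w).
pose V w := deviation P0 k (fun i => Z0 i w).
pose B th w := deviation P0 (fiber_kernel H (K th)) (fun i => Z0 i w).
pose D th := mmd H (Pjoint th) P0.
have cU : concentrated Pr n U.
  exact: (deviation_concentrated n_gt0 pdG mG G1 Z0_iid).
have cV : concentrated Pr n V.
  exact: (deviation_concentrated n_gt0 (pd_rkhs H) k_meas k_le1 Z0_iid).
have cB th : concentrated Pr n (B th).
  have pdF := pd_fiber_kernel H (K th).
  have mF := measurable_fiber_kernel H k_meas k_le1 (mK th).
  have F1 := fiber_kernel_le1 H k_meas k_le1 (K th).
  exact: (deviation_concentrated n_gt0 pdF mF F1 Z0_iid).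
have D0 th : 0 <= D th by exact: normr_ge0.
have le_mmd th w : mmd H (Pjoint (thn w)) P0 <=
    8 * eps + D th + frakC * U w + 2 * V w + B th w.
  pose m t := mean_embedding H (Pjoint t).
  pose e0 := mean_embedding H (empirical_measure R (fun i => Z0 i w)).
  pose e1 := mean_embedding H (empirical_measure R (fun i => Z i w)).
  pose f0 t := mean_embedding H (model_empirical_measure (K t) (fun i => Z0 i w)).
  pose f1 t := mean_embedding H (model_empirical_measure (K t) (fun i => Z i w)).
  have e01 : `|e1 - e0| <= 2 * eps.
    rewrite /e1 /e0 !mean_embedding_empirical //.
    apply: contamination_mean (Z_contam w); exact: norm_feature_le1.
  have f01 t : `|f1 t - f0 t| <= 2 * eps.
    rewrite /f1 /f0 !mean_embedding_model_empirical //.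
    apply: (contamination_mean (phi := fun z => fiber_mean H (K t) z.1) _ (Z_contam w)).
    by move=> z; exact: norm_fiber_mean_le1.
  pose p := mean_embedding H P0.
  have e0P : `|e0 - p| = V w by exact: mmd_empirical.
  have mf0 t : `|m t - f0 t| = B t w.
    exact: (mmd_model H k_meas k_le1 (mK t) (Pjoint_law t) _ n_gt0).
  (* True at each [w] for all [t] together, so it may be used at [thn w]. The fixed [th] keeps its
     own deviation [B th w], concentrated with constant 1; bounding that one by [U] too would give
     [2 * frakC + 2] in place of [frakC + 3]. *)
  have BU t : B t w <= frakC * U w.
    have := domG (K t) (C t) (mK t) (C_cme t) (C_bounded t) P0 n (fun i => Z0 i w).
    by move/le_trans; apply; rewrite ler_wpM2r // sqrtr_ge0.
  have argmin : `|f1 (thn w) - e1| <= `|f1 th - e1|.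
    by have := thn_argmin w th; rewrite ler_pXn2r // nnegrE normr_ge0.
  rewrite /D /mmd -/p -/(m th) -/(m (thn w)).
  clearbody m p e0 e1 f0 f1.
  rewrite -e0P -mf0; apply: minimizer_le argmin _ => //.
  by rewrite mf0.
split; first exact: (outer_expectation_bound point D0 frakC0 cU cV cB le_mmd).
move=> eta eta01.
exact: (inner_probability_bound n_gt0 point D0 frakC0 cU cV cB le_mmd eta01).
Qed.
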